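(* Consider the Gumbel-max watermark model of the context with $\varepsilon_n\asymp n^{-p}$, and suppose Assumptions (A) and (B) hold with constants $p,q\ge 0$. Let $h:[0,1]\to\mathbb{R}$ be a score function that is (i) non-decreasing, (ii) non-constant, (iii) parameter-free (for every $y$, $h(y)$ does not depend on $\Delta_n$ or $\varepsilon_n$), and (iv) has no discontinuity at $0$ and no discontinuity at $1$. Let $a_n$ be a positive sequence with $a_n\to\infty$ and $a_n/n^{\gamma}\to 0$ for every $\gamma>0$, let $C>0$ be a constant, and consider the sum-based rule $T_h(Y_{1:n})=1$ (reject $H_0$) if $\sum_{t=1}^n h(Y_t)\ge n\,\mathbb{E}_0 h(Y)+C n^{1/2}a_n$, and $T_h=0$ otherwise, where $\mathbb{E}_0$ denotes expectation for $Y\sim U(0,1)$. Then: (1) if $q+p<\frac12$, the sum of Type I and Type II errors of $T_h$ tends to $0$; (2) if $q+p>\frac12$, the sum of Type I and Type II errors of $T_h$ tends to $1$.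
   Context: Notation: $a_n \asymp b_n$ means there are constants $C_1,C_2>0$ with $C_1 a_n\le b_n\le C_2 a_n$ for all $n$. $\mathcal{W}$ is a finite vocabulary. For a probability vector $\mathbf{P}=(P_w)_{w\in\mathcal{W}}$, $\mu_{1,\mathbf{P}}$ is the distribution on $[0,1]$ with CDF $F_{1,\mathbf{P}}(r)=\sum_w P_w r^{1/P_w}$; $\mu_0=U(0,1)$. Watermark model: for $t=1,\dots,n$ a random next-token distribution $\mathbf{P}_t$ is produced, $\xi_t=(U_{t,w})_{w\in\mathcal{W}}$ has i.i.d. $U(0,1)$ entries, the decoder is $\mathcal{S}(\mathbf{P},\xi)=\arg\max_w \frac{\log U_w}{P_w}$, the observed token is $w_t$ and $Y_t=U_{t,w_t}$. Let $\mathcal{F}_{t-1}=\sigma(\{w_j,\xi_j,\mathbf{P}_{j+1}\}_{j=1}^{t-1})$. Assumption (A): (a) $\xi_1,\dots,\xi_n$ are i.i.d. and $\xi_t$ is independent of $\mathcal{F}_{t-1}$; (b) with probability $\varepsilon_n$, $w_t=\mathcal{S}(\mathbf{P}_t,\xi_t)$; otherwise $w_t$ is drawn from $\mathbf{P}_t$ and, conditionally on $\mathcal{F}_{t-1}$, is independent of $\xi_t$. Assumption (B): $\Delta(\mathbf{P}_t):=1-\max_w P_{t,w}=\Delta_n$ for all $t\le n$, with $\Delta_n\asymp n^{-q}$. $H_1^{\mathrm{mix}}$ is the law of $Y_{1:n}$ under this model; $H_0$: $Y_1,\dots,Y_n$ i.i.d. $U(0,1)$. *)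

(* Defs.v *)
From HB Require Import structures.
From mathcomp Require Import all_boot all_order all_algebra.
From mathcomp Require Import all_classical all_reals all_analysis.
Set Implicit Arguments. Unset Strict Implicit. Unset Printing Implicit Defensive.
Import Order.TTheory GRing.Theory Num.Theory.
Import numFieldNormedType.Exports.
Local Open Scope classical_set_scope.
Local Open Scope ring_scope.

Section GumbelDefs.
Variable R : realType.

(* Two real sequences are of the same order: a_n ≍ b_n, stated for n >= 1
   (at n = 0 the power n^{-q} is degenerate). *)
Definition asymp (a b : nat -> R) : Prop :=
  exists C1 C2 : R, 0 < C1 /\ 0 < C2 /\
    forall n : nat, (1 <= n)%N -> C1 * a n <= b n /\ b n <= C2 * a n.

Definition npow (p : R) (n : nat) : R := (n%:R) `^ (- p).

Variable W : finType.

Definition prob_vector (P : W -> R) : Prop :=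
  (forall w, 0 <= P w) /\ \sum_(w : W) P w = 1.

Definition Delta (P : W -> R) : R := 1 - \big[Num.max/0]_(w : W) P w.

Definition gumbel_score (P : W -> R) (u : W -> R) (w : W) : \bar R :=
  if 0 < P w then (ln (u w) / P w)%:E else -oo%E.

Definition is_gumbel_max (P : W -> R) (u : W -> R) (w : W) : Prop :=
  forall w' : W, (gumbel_score P u w' <= gumbel_score P u w)%E.

End GumbelDefs.

Section ProbDefs.
Context {R : realType} {d : measure_display} {T : measurableType d}.

Definition indep_sets (Pr : probability T R) (G1 G2 : set (set T)) : Prop :=
  forall A E, G1 A -> G2 E -> Pr (A `&` E) = (Pr A * Pr E)%E.

Definition preimages (X : T -> R) : set (set T) :=
  [set A | exists B : set R, measurable B /\ A = X @^-1` B].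

Definition uniform01_law (Pr : probability T R) (X : T -> R) : Prop :=
  forall B : set R, measurable B ->
    Pr (X @^-1` B) = lebesgue_measure (B `&` `[0, 1]).

End ProbDefs.

Section Model.
Context {R : realType} {W : finType} {d : measure_display} {T : measurableType d}.
Variables (Pr : probability T R) (n : nat) (eps Dn : R).
Variables (Pv : nat -> W -> T -> R)   (* P_t, tokens indexed 0 .. n-1 *)
          (xi : nat -> W -> T -> R)   (* xi_t = (U_{t,w})_w *)
          (wt : nat -> T -> W)        (* observed token w_t *)
          (B : nat -> T -> bool).     (* B_t : token t is watermarked *)

(* generating family of F_{t}: information available before token t
   (0-based), i.e. P_0..P_t, w_0..w_{t-1}, xi_0..xi_{t-1} *)
Definition Fgen (t : nat) : set (set T) :=
  [set A | (exists j w, (j <= t)%N /\ preimages (Pv j w) A)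
        \/ (exists j w, (j < t)%N /\ A = wt j @^-1` [set w])
        \/ (exists j w, (j < t)%N /\ preimages (xi j w) A)].

Definition Xgen (t : nat) : set (set T) :=
  [set A | exists w, preimages (xi t w) A].

Definition Yt (t : nat) (x : T) : R := xi t (wt t x) x.

Definition watermark_model : Prop :=
  (forall t w, (t < n)%N -> measurable_fun setT (Pv t w)) /\
  (forall t w, (t < n)%N -> measurable_fun setT (xi t w)) /\
  (forall t w, (t < n)%N -> measurable (wt t @^-1` [set w])) /\
  (forall t, (t < n)%N -> measurable [set x | B t x]) /\
  (* P_t is a next-token probability vector; Assumption (B): Delta(P_t) = Delta_n *)
  (forall t x, (t < n)%N -> prob_vector (fun w => Pv t w x) /\
                            Delta (fun w => Pv t w x) = Dn) /\
  (* Assumption (A)(a): entries of xi_t i.i.d. U(0,1) *)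
  (forall t, (t < n)%N -> forall w, uniform01_law Pr (xi t w)) /\
  (forall t, (t < n)%N -> forall E : W -> set R, (forall w, measurable (E w)) ->
     Pr (\bigcap_(w in [set: W]) (xi t w @^-1` E w)) =
     (\prod_(w : W) Pr (xi t w @^-1` E w))%E) /\
  (forall E : nat -> set T, (forall t, (t < n)%N -> <<s Xgen t >> (E t)) ->
     Pr (\bigcap_(t in `I_n) E t) = (\prod_(t < n) Pr (E t))%E) /\
  (forall t, (t < n)%N -> indep_sets Pr <<s Fgen t >> <<s Xgen t >>) /\
  (* Assumption (A)(b): with probability eps (independently of F_{t-1} and
     xi_t) the token is watermarked ... *)
  (forall t, (t < n)%N -> forall A E, <<s Fgen t >> A -> <<s Xgen t >> E ->
     Pr (A `&` E `&` [set x | B t x]) = (eps%:E * Pr A * Pr E)%E) /\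
  (* ... and then w_t = S(P_t, xi_t) ... *)
  (forall t x, (t < n)%N -> B t x ->
     is_gumbel_max (fun w => Pv t w x) (fun w => xi t w x) (wt t x)) /\
  (* ... otherwise w_t is drawn from P_t and, conditionally on F_{t-1},
     is independent of xi_t *)
  (forall t, (t < n)%N -> forall A E (w : W), <<s Fgen t >> A -> <<s Xgen t >> E ->
     Pr (A `&` E `&` [set x | ~~ B t x] `&` wt t @^-1` [set w]) =
     ((1 - eps)%:E * (\int[Pr]_(x in A) (Pv t w x)%:E) * Pr E)%E).

End Model.

Definition E0 {R : realType} (h : R -> R) : R :=
  fine (\int[@lebesgue_measure R]_(x in `[0%R, 1%R]) (h x)%:E)%E.

(* projection of R onto [0,1]; h is only given on [0,1] (Y_t lies in [0,1]
   almost surely), so the rule evaluates h at clamp01 (Y_t) *)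
Definition clamp01 {R : realType} (y : R) : R := Num.min (Num.max y 0) 1.

Definition Th_reject {R : realType} (h : R -> R) (C : R) (a : nat -> R)
  (n : nat) (y : nat -> R) : bool :=
  n%:R * E0 h + C * Num.sqrt n%:R * a n <= \sum_(t < n) h (clamp01 (y t)).

Definition H0_model {R : realType} {d : measure_display} {T : measurableType d}
  (Pr : probability T R) (n : nat) (Y : nat -> T -> R) : Prop :=
  (forall t, (t < n)%N -> measurable_fun setT (Y t)) /\
  (forall E : nat -> set R, (forall t, measurable (E t)) ->
     Pr (\bigcap_(t in `I_n) (Y t @^-1` E t)) =
     (\prod_(t < n) lebesgue_measure (E t `&` `[0%R, 1%R]))%E).

(* Main.v *)
(** The errors are controlled by exponential moments with parameter
    [lam = n^(-1/2)]: if [Z_t] is bounded and has conditional mean at most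
    [delta] given the past, then [P (sum Z_t >= s)] is at most
    [exp (- lam s + n lam delta + O(n lam^2))], so the quadratic term is bounded.

    Under H0 the drift of [h(Y_t) - E0 h] vanishes. Under the mixture, an
    unwatermarked token is independent of [xi_t] and contributes no drift, and a
    watermarked token is compared with the uniform [U_v] of the modal token [v],
    whose probability is exactly [1 - Delta_n]. The Gumbel-max token satisfies
    [U_w >= U_v]. It differs from [v] with probability [O(Delta_n)], which
    gives a drift [O(eps_n Delta_n)]. Conversely, some runner-up [i] has
    probability at least [Delta_n / |W|]; the box where [U_v] is small, [U_i] is
    within order [Delta_n] of [1] and the other [U_w] are large has probability
    of order [Delta_n], and on it [h] increases by a fixed amount, which gives a
    drift of order [eps_n Delta_n]. Hence [n^(1/2) eps_n Delta_n], of order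
    [n^(1/2 - p - q)], is compared with [a_n]. *)
Require Import Defs.
From HB Require Import structures.
From mathcomp Require Import all_boot all_order all_algebra.
From mathcomp Require Import all_classical all_reals all_analysis.
From mathcomp Require Import measurable_realfun lra ring.
Import Order.TTheory GRing.Theory Num.Theory.
Import numFieldNormedType.Exports.
Local Open Scope classical_set_scope.
Local Open Scope ring_scope.

(** * Bounded measurable functions *)

Lemma indic_set_bool {R : pzRingType} {T : Type} (b : T -> bool) (x : T) :
  \1_[set y | b y] x = (b x)%:R :> R.
Proof. by rewrite indicE; congr (_%:R); congr nat_of_bool; apply/idP/idP; rewrite inE. Qed.

Section bounded_measurable.
Context {R : realType} {d : measure_display} {T : measurableType d}.
Implicit Types (f g : T -> R) (A : set T).

(** Boundedness is asked at every point, so such functions are integrable for every probability and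
    the integral is linear on them without further conditions. *)
Definition bmeas f := measurable_fun setT f /\ exists M : R, forall x, `|f x| <= M.

Lemma bmeas_cst (c : R) : bmeas (fun=> c).
Proof. by split; [exact: measurable_cst | exists `|c|]. Qed.

Lemma bmeasD f g : bmeas f -> bmeas g -> bmeas (fun x => f x + g x).
Proof.
move=> [mf [M fM]] [mg [N gN]]; split; first exact: measurable_funD.
by exists (M + N) => x; apply: le_trans (ler_normD _ _) _; exact: lerD.
Qed.

Lemma bmeasM f g : bmeas f -> bmeas g -> bmeas (fun x => f x * g x).
Proof.
move=> [mf [M fM]] [mg [N gN]]; split; first exact: measurable_funM.
by exists (M * N) => x; rewrite normrM; exact: ler_pM.
Qed.

Lemma bmeasZ c f : bmeas f -> bmeas (fun x => c * f x).
Proof. by move=> bf; apply: bmeasM => //; exact: bmeas_cst. Qed.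

Lemma bmeasN f : bmeas f -> bmeas (fun x => - f x).
Proof.
move=> [mf [M fM]]; split; first exact: measurableT_comp.
by exists M => x; rewrite normrN.
Qed.

Lemma bmeasB f g : bmeas f -> bmeas g -> bmeas (fun x => f x - g x).
Proof. by move=> bf /bmeasN; exact: bmeasD. Qed.

Lemma bmeas_indic A : measurable A -> bmeas (\1_A : T -> R).
Proof.
move=> mA; split; first exact: measurable_indic.
by exists 1 => x; rewrite indicE ger0_norm// lern1; case: (_ \in _).
Qed.

Lemma bmeas_sum (I : Type) (s : seq I) (Q : pred I) (F : I -> T -> R) :
  (forall i, bmeas (F i)) -> bmeas (fun x => \sum_(i <- s | Q i) F i x).
Proof.
move=> bF; elim: s => [|i s IH].
  by under eq_fun do rewrite big_nil; exact: bmeas_cst.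
under eq_fun do rewrite big_cons; case: (Q i) => //.
exact: bmeasD.
Qed.

Lemma measurable_sum_ord (Z : nat -> T -> R) (m : nat) :
  (forall t, (t < m)%N -> measurable_fun setT (Z t)) ->
  measurable_fun setT (fun x => \sum_(t < m) Z t x).
Proof.
elim: m => [_|m IH mZ]; first by under eq_fun do rewrite big_ord0; exact: measurable_cst.
under eq_fun do rewrite big_ord_recr/=.
by apply: measurable_funD; [apply: IH => t tm; apply: mZ; exact: ltnW | exact: mZ].
Qed.

End bounded_measurable.

Lemma bmeas_comp {R : realType} {d d' : measure_display} {T : measurableType d}
    {S : measurableType d'} (f : S -> R) (X : T -> S) :
  measurable_fun setT X -> bmeas f -> bmeas (fun x => f (X x)).
Proof.
move=> mX [mf [M fM]]; split; first exact: measurableT_comp mf mX.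
by exists M.
Qed.

Section expectation.
Context {R : realType} {d : measure_display} {T : measurableType d}.
Variable P : probability T R.
Implicit Types (f g : T -> R) (A : set T).

Lemma bmeas_integrable {f} : bmeas f -> P.-integrable setT (EFin \o f).
Proof.
move=> [mf [M fM]]; apply: measurable_bounded_integrable => //.
  by rewrite (le_lt_trans (probability_le1 P measurableT)) ?ltry.
exists M; split; first by rewrite num_real.
by move=> y My x _; apply: le_trans (fM x) (ltW My).
Qed.

Lemma RintD f g : bmeas f -> bmeas g ->
  \int[P]_x (f x + g x) = \int[P]_x f x + \int[P]_x g x.
Proof. by move=> bf bg; rewrite RintegralD//; exact: bmeas_integrable. Qed.

Lemma RintB f g : bmeas f -> bmeas g ->
  \int[P]_x (f x - g x) = \int[P]_x f x - \int[P]_x g x.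
Proof. by move=> bf bg; rewrite RintegralB//; exact: bmeas_integrable. Qed.

Lemma RintZ c f : bmeas f -> \int[P]_x (c * f x) = c * \int[P]_x f x.
Proof. by move=> bf; rewrite RintegralZl//; exact: bmeas_integrable. Qed.

Lemma Rint_sum (I : Type) (s : seq I) (Q : pred I) (F : I -> T -> R) :
  (forall i, bmeas (F i)) ->
  \int[P]_x (\sum_(i <- s | Q i) F i x) = \sum_(i <- s | Q i) \int[P]_x F i x.
Proof.
move=> bF; elim: s => [|i s IH].
  rewrite big_nil; under eq_Rintegral do rewrite big_nil.
  by rewrite Rintegral_cst// mul0r.
rewrite big_cons; under eq_Rintegral do rewrite big_cons.
case: (Q i) => //; rewrite RintD ?IH//; exact: bmeas_sum.
Qed.

Lemma le_Rint f g : bmeas f -> bmeas g -> (forall x, f x <= g x) ->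
  \int[P]_x f x <= \int[P]_x g x.
Proof.
by move=> bf bg fg; apply: le_Rintegral => //; exact: bmeas_integrable.
Qed.

Lemma Rint_indic A : measurable A -> \int[P]_x \1_A x = fine (P A).
Proof. by move=> mA; rewrite /Rintegral integral_indic// setIT. Qed.

Lemma Rint_cst c : \int[P]_x c = c.
Proof.
transitivity (c * fine (P setT)); first exact: Rintegral_cst.
by rewrite probability_setT mulr1.
Qed.

Lemma le_norm_Rint f b : bmeas f -> (forall x, `|f x| <= b) ->
  `|\int[P]_x f x| <= b.
Proof.
move=> bf fb; rewrite -[b]Rint_cst.
apply: le_trans (le_normr_Rintegral _ (bmeas_integrable bf)) _ => //.
apply: le_Rint => //; last exact: bmeas_cst.
case: bf => mf [M fM]; split; first exact: measurableT_comp.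
by exists M => x; rewrite normr_id.
Qed.

End expectation.

(** * Bounded linear functionals controlled by their values on indicators *)

Section positive_functional.
Context {R : realType} {d : measure_display} {T : measurableType d}.

(** Continuity is for the uniform norm: [b] stands for any uniform bound of [f]. *)
Definition bounded_functional (L : (T -> R) -> R) :=
  [/\ forall f g, bmeas f -> bmeas g -> L (fun x => f x + g x) = L f + L g,
      forall c f, bmeas f -> L (fun x => c * f x) = c * L f &
      exists K : R, forall f (b : R), bmeas f -> (forall x, `|f x| <= b) -> `|L f| <= K * b].

(** The sum counts the integers of $1,\dots,N$ that are at most $y$, so it is the smaller of $N$ and
    the integer part of $y$. *)
Lemma staircase_approx (y : R) (N : nat) : 0 <= y ->
  (N%:R <= y -> \sum_(k < N) (k.+1%:R <= y)%R%:R = N%:R :> R) /\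
  (y < N%:R -> y - 1 <= \sum_(k < N) (k.+1%:R <= y)%R%:R <= y).
Proof.
move=> y0; elim: N => [|N [IH1 IH2]].
  by split; [rewrite big_ord0 | rewrite ltNge y0].
rewrite big_ord_recr/=; split=> hN.
  rewrite hN IH1 ?natr1//; apply: le_trans hN; by rewrite ler_nat.
rewrite [N.+1%:R <= y]leNgt hN addr0; have [yN|Ny] := ltP y N%:R; first exact: IH2.
by rewrite IH1// Ny andbT lerBlDr natr1 ltW.
Qed.

(** A bounded $X \ge 0$ is within $M/N$, uniformly, of a staircase, a nonnegative combination of
    indicators of level sets. [L] is at most 0 on staircases, so $L X \le K M / N$ for every $N$. *)
Lemma bounded_functional_le0 (L : (T -> R) -> R) (X : T -> R) :
  bounded_functional L -> (forall A, measurable A -> L \1_A <= 0) ->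
  bmeas X -> (forall x, 0 <= X x) -> L X <= 0.
Proof.
move=> [LD LZ [K LK]] LA bX X0.
(* The bound is strict, whence the added 1 in the witness, so that [X] stays strictly below the
   [N]-th multiple of the step $M/N$. *)
have [M M0 XM] : exists2 M : R, 0 < M & forall x, X x < M.
  case: bX => _ [M XM]; exists (`|M| + 1); first by rewrite ltr_wpDl.
  move=> x; apply: le_lt_trans (ler_norm _) _; apply: le_lt_trans (XM x) _.
  by apply: le_lt_trans (ler_norm _) _; rewrite ltrDl.
pose A N k := [set x | k.+1%:R * (M / N%:R) <= X x].
have mA N k : measurable (A N k).
  rewrite (_ : A N k = X @^-1` `[k.+1%:R * (M / N%:R), +oo[).
    by rewrite -[X in measurable X]setTI; apply: bX.1 => //.
  by apply/seteqP; split=> x /=; rewrite in_itv/= andbT.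
pose S N m := fun x => \sum_(k < m) (M / N%:R) * \1_(A N k) x.
have bS N m : bmeas (S N m).
  by apply: bmeas_sum => k; apply: bmeasZ; exact: bmeas_indic.
have LS N m : L (S N m) <= 0.
  elim: m => [|m IH].
    rewrite (_ : S N 0%N = fun x => 0 * (cst 0 x : R)).
      by rewrite LZ ?mul0r//; exact: bmeas_cst.
    by apply/funext => x; rewrite /S big_ord0 mul0r.
  rewrite (_ : S N m.+1 = fun x => S N m x + (M / N%:R) * \1_(A N m) x).
    rewrite LD ?LZ//; [|exact: bmeas_indic|].
      rewrite -[leRHS]addr0 lerD// mulr_ge0_le0 ?LA// divr_ge0//; exact: ltW.
    by apply: bmeasZ; exact: bmeas_indic.
  by apply/funext => x; rewrite /S big_ord_recr.
have K0 : 0 <= K.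
  have h01 (x : T) : `|(fun=> 0) x : R| <= 1 by rewrite normr0.
  by have := LK _ _ (bmeas_cst 0) h01; rewrite mulr1; exact: le_trans.
have LX N : (0 < N)%N -> L X <= K * (M / N%:R).
  move=> N0; have N0' : (0 : R) < N%:R by rewrite ltr0n.
  pose D x := X x + (-1) * S N N x.
  have bD : bmeas D by apply: bmeasD => //; exact: bmeasZ.
  have -> : X = fun x => D x + S N N x.
    by apply/funext => x; rewrite /D mulN1r subrK.
  rewrite LD// -[leRHS]addr0 lerD//; apply: le_trans (ler_norm _) _.
  apply: LK => // x.
  have MN : 0 < M / N%:R by rewrite divr_gt0.
  have y0 : 0 <= X x / (M / N%:R) by rewrite divr_ge0// ltW.
  have yN : X x / (M / N%:R) < N%:R.
    by rewrite ltr_pdivrMr// mulrCA divff ?mulr1// gt_eqF.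
  have [_ /(_ yN)/andP[l u]] := staircase_approx _ N y0.
  have SE : S N N x = (M / N%:R) * \sum_(k < N) (k.+1%:R <= X x / (M / N%:R))%R%:R.
    rewrite /S mulr_sumr; apply: eq_bigr => k _.
    by rewrite indic_set_bool ler_pdivlMr.
  have XE : X x = (M / N%:R) * (X x / (M / N%:R)).
    by rewrite mulrCA divff ?mulr1// gt_eqF.
  rewrite /D mulN1r XE SE -mulrBr normrM gtr0_norm// ger_pMr// ger0_norm ?subr_ge0//.
  by rewrite lerBlDr -lerBlDl.
(* If [L X] were positive, an integer [N] above [K * M / L X] would contradict [LX]. *)
rewrite leNgt; apply/negP => LX0.
have KM : 0 <= K * M by rewrite mulr_ge0// ltW.
have := @archi_boundP _ (K * M / L X) (divr_ge0 KM (ltW LX0)).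
set N := Num.bound _ => hN.
have N0 : (0 < N)%N by rewrite -(ltr_nat R); apply: le_lt_trans hN; rewrite divr_ge0// ltW.
have := LX _ N0; rewrite mulrA ler_pdivlMr ?ltr0n//.
by move: hN; rewrite ltr_pdivrMr// => h1 h2; lra.
Qed.

(** For nonnegative functions the one-sided result applies to both [L] and its opposite. In general
    $X = (X + M) - M$, where $X + M$ and the constant $M$ are nonnegative. *)
Lemma bounded_functional_eq0 (L : (T -> R) -> R) (X : T -> R) :
  bounded_functional L -> (forall A, measurable A -> L \1_A = 0) ->
  bmeas X -> L X = 0.
Proof.
move=> BL LA.
have BLN : bounded_functional (fun f => - L f).
  case: BL => [LD LZ [K LK]]; split.
  + by move=> f g bf bg; rewrite LD// opprD.
  + by move=> c f bf; rewrite LZ// mulrN.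
  + by exists K => f b bf fb; rewrite normrN LK.
have pos (Y : T -> R) : bmeas Y -> (forall x, 0 <= Y x) -> L Y = 0.
  move=> bY Y0; apply/eqP; rewrite eq_le; apply/andP; split.
    by apply: bounded_functional_le0 => // A mA; rewrite LA.
  rewrite -oppr_le0; apply: (bounded_functional_le0 _ _ BLN) => // A mA.
  by rewrite LA// oppr0.
move=> bX; have [_ [M XM]] := bX.
have bXM : bmeas (fun x => X x + M) by apply: bmeasD => //; exact: bmeas_cst.
have XM0 x : 0 <= X x + M by have := XM x; rewrite ler_norml => /andP[+ _]; lra.
have := pos _ bXM XM0; case: BL => LD _ _; rewrite LD//; last exact: bmeas_cst.
by rewrite (pos _ (bmeas_cst M)) ?addr0// => x; exact: le_trans (XM x).
Qed.

End positive_functional.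

(** * Exponential tail bound *)

(** Inverting $1 - u \le e^{-u}$ gives $e^u \le 1/(1-u)$, and $(1 + u + 2u^2)(1 - u) = 1 + u^2(1 -
    2u) \ge 1$. *)
Lemma expR_le_quadratic {R : realType} (u : R) :
  u <= 1 / 2 -> expR u <= 1 + u + 2 * u ^+ 2.
Proof.
move=> u2; have u1 : 0 < 1 - u by lra.
have hN : 1 - u <= expR (- u) by exact: expR_ge1Dx.
have -> : expR u = (expR (- u))^-1 by rewrite expRN invrK.
apply: (@le_trans _ _ (1 - u)^-1); first by rewrite lef_pV2// posrE expR_gt0.
rewrite -div1r ler_pdivrMr//.
have : 0 <= u ^+ 2 * (1 - 2 * u) by rewrite mulr_ge0// ?sqr_ge0//; lra.
rewrite !expr2; lra.
Qed.

Section exponential_tail.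
Context {R : realType} {d : measure_display} {T : measurableType d}.
Variable P : probability T R.

Lemma sub_sigma_measurable (G : set (set T)) :
  G `<=` measurable -> <<s G >> `<=` measurable.
Proof.
by move=> Gm; apply: smallest_sub => //; exact: sigma_algebra_measurable.
Qed.

Lemma sub_sigma_bmeas (G : set (set T)) (f : T -> R) : G `<=` measurable ->
  @bmeas R _ (g_sigma_algebraType G) f -> bmeas f.
Proof.
move=> /sub_sigma_measurable Gm [mf bf]; split=> // _ B mB.
by apply: Gm; exact: mf.
Qed.

(** The hypothesis on sets says that the conditional mean of [Z] given the sigma-algebra of [G] is
    at most [delta]. It extends to nonnegative weights measurable for that sigma-algebra, because $f
    \mapsto E[f (Z - \delta)]$ is a bounded functional that is at most 0 on indicators. *)
Lemma le_sub_sigma_Rint (G : set (set T)) (Z X : T -> R) (delta : R) :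
  G `<=` measurable -> bmeas Z ->
  (forall A, <<s G >> A -> \int[P]_x (\1_A x * Z x) <= delta * fine (P A)) ->
  @bmeas R _ (g_sigma_algebraType G) X -> (forall x, 0 <= X x) ->
  \int[P]_x (X x * Z x) <= delta * \int[P]_x X x.
Proof.
move=> Gm bZ ZA bX X0.
have bm (f : T -> R) : @bmeas R _ (g_sigma_algebraType G) f ->
  bmeas (fun x => f x * (Z x - delta)).
  move=> /(sub_sigma_bmeas _ _ Gm) bf; apply: bmeasM => //.
  by apply: bmeasB => //; exact: bmeas_cst.
have split_int (f : T -> R) : bmeas f ->
    \int[P]_x (f x * (Z x - delta)) =
    \int[P]_x (f x * Z x) - delta * \int[P]_x f x.
  move=> bf; rewrite -RintZ// -RintB; [|exact: bmeasM|exact: bmeasZ].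
  by apply: eq_Rintegral => x _; ring.
have bX' := sub_sigma_bmeas _ _ Gm bX.
pose L (f : g_sigma_algebraType G -> R) := \int[P]_x (f x * (Z x - delta)).
suff : L X <= 0 by rewrite /L split_int// subr_le0.
apply: (@bounded_functional_le0 R _ (g_sigma_algebraType G)) => //.
  split.
  - move=> f g bf bg; rewrite /L -RintD; [|by apply: bm|by apply: bm].
    by apply: eq_Rintegral => x _; rewrite mulrDl.
  - move=> c f bf; rewrite /L -RintZ; last by apply: bm.
    by apply: eq_Rintegral => x _; rewrite mulrA.
  - case: (bZ) => _ [M ZM]; exists (M + `|delta|) => f b bf fb.
    apply: le_norm_Rint; first by apply: bm.
    move=> x; rewrite normrM mulrC ler_pM//.
    by apply: le_trans (ler_normB _ _) _; rewrite lerD2r.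
move=> A mA; have mA' : d.-measurable (A : set T) by exact: (sub_sigma_measurable _ Gm).
rewrite /L split_int; last exact: bmeas_indic.
by rewrite Rint_indic// subr_le0; exact: ZA.
Qed.

(** A Chernoff bound. Each step multiplies the exponential moment by at most $1 + \kappa \le
    e^{\kappa}$, since the partial sum before [t] is measurable for the past [G t]. The sign of
    [delta] is free; a negative value expresses a drift away from the threshold. *)
Lemma exponential_tail_bound (n : nat) (G : nat -> set (set T))
    (Z : nat -> T -> R) (M delta lam s : R) :
  (forall t, (t < n)%N -> G t `<=` measurable) ->
  (forall t, (t < n)%N -> measurable_fun setT (Z t)) ->
  (forall k t, (k < t < n)%N ->
     measurable_fun [set: g_sigma_algebraType (G t)] (Z k)) ->
  (forall t x, (t < n)%N -> `|Z t x| <= M) ->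
  (forall t A, (t < n)%N -> <<s G t >> A ->
     \int[P]_x (\1_A x * Z t x) <= delta * fine (P A)) ->
  0 <= lam -> lam * M <= 1 / 2 ->
  fine (P [set x | s <= \sum_(t < n) Z t x]) <=
  expR (- lam * s + n%:R * (lam * delta + 2 * (lam * M) ^+ 2)).
Proof.
move=> Gm mZ adZ ZM condZ lam0 lamM.
have bsum d' (T' : measurableType d') (Y : nat -> T' -> R) m :
    (forall t, (t < m)%N -> measurable_fun setT (Y t)) ->
    (forall t x, (t < m)%N -> `|Y t x| <= M) ->
    bmeas (fun x => expR (lam * \sum_(t < m) Y t x)).
  move=> mY YM; split.
    apply: measurableT_comp; first exact: measurable_expR.
    apply: measurable_funM; first exact: measurable_cst.
    exact: measurable_sum_ord.
  exists (expR (lam * (m%:R * M))) => x.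
  rewrite ger0_norm ?expR_ge0// ler_expR ler_wpM2l//.
  apply: le_trans (ler_norm _) _; apply: le_trans (ler_norm_sum _ _ _) _.
  rewrite -[m in m%:R]card_ord mulr_natl -sumr_const.
  by apply: ler_sum => i _; exact: YM.
set kap := lam * delta + 2 * (lam * M) ^+ 2.
have moment k : (k <= n)%N ->
    \int[P]_x expR (lam * \sum_(t < k) Z t x) <= expR (k%:R * kap).
  elim: k => [_|k IH kn].
    under eq_Rintegral do rewrite big_ord0 mulr0 expR0.
    by rewrite Rint_cst mul0r expR0.
  pose X x := expR (lam * \sum_(t < k) Z t x).
  have bX : @bmeas R _ (g_sigma_algebraType (G k)) X.
    apply: bsum => [t tk|t x tk]; first by apply: adZ; rewrite tk.
    by apply: ZM; exact: ltn_trans kn.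
  have bX' : bmeas X by exact: (sub_sigma_bmeas _ _ (Gm _ kn)).
  have bZ : bmeas (Z k) by split; [exact: mZ | exists M => x; exact: ZM].
  have X0 x : 0 <= X x by exact: expR_ge0.
  (* With the quadratic term replaced by its largest value, the integrand is affine in [Z k], and
     only the conditional mean of [Z k] matters. *)
  apply: (@le_trans _ _ (\int[P]_x ((1 + 2 * (lam * M) ^+ 2) * X x + lam * (X x * Z k x)))).
    apply: le_Rint.
    - apply: bsum => [t tk|t x tk]; first by apply: mZ; exact: leq_trans kn.
      by apply: ZM; exact: leq_trans kn.
    - by apply: bmeasD; [exact: bmeasZ | apply: bmeasZ; exact: bmeasM].
    move=> x; rewrite big_ord_recr/= mulrDr expRD -/(X x).
    have zM : `|lam * Z k x| <= lam * M.
      by rewrite normrM ger0_norm// ler_wpM2l//; exact: ZM.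
    have /expR_le_quadratic E : lam * Z k x <= 1 / 2.
      by apply: le_trans (ler_norm _) _; exact: le_trans lamM.
    have sq : (lam * Z k x) ^+ 2 <= (lam * M) ^+ 2.
      by rewrite -[leLHS]real_normK ?num_real// ler_sqr ?nnegrE// (le_trans _ zM).
    have := ler_wpM2l (X0 x) E; have := ler_wpM2l (X0 x) sq; lra.
  rewrite RintD; [|exact: bmeasZ|by apply: bmeasZ; exact: bmeasM].
  rewrite !RintZ//; last exact: bmeasM.
  have lX := le_sub_sigma_Rint _ _ _ _ (Gm _ kn) bZ (fun A => condZ k A kn) bX X0.
  have iX0 : 0 <= \int[P]_x X x by exact: Rintegral_ge0.
  have iX := IH (ltnW kn).
  have step : (1 + kap) * \int[P]_x X x <= expR kap * expR (k%:R * kap).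
    apply: (@le_trans _ _ (expR kap * \int[P]_x X x)).
      by rewrite ler_wpM2r// expR_ge1Dx.
    by rewrite ler_wpM2l// expR_ge0.
  have -> : expR (k.+1%:R * kap) = expR kap * expR (k%:R * kap).
    by rewrite -expRD -natr1 mulrDl mul1r addrC.
  apply: le_trans step.
  have := ler_wpM2l lam0 lX; rewrite /kap; lra.
have mS := measurable_sum_ord Z n mZ.
have mE : measurable [set x | s <= \sum_(t < n) Z t x].
  rewrite -[X in measurable X]setTI.
  by apply: measurable_fun_le => //; exact: measurable_cst.
have bE := bsum _ _ Z n mZ ZM.
rewrite -Rint_indic// expRD.
(* Markov's inequality: on the event the exponential of [lam] times the excess over [s] is at least
   1. *)
apply: (@le_trans _ _ (\int[P]_x (expR (- lam * s) * expR (lam * \sum_(t < n) Z t x)))).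
  apply: le_Rint; [exact: bmeas_indic|exact: bmeasZ|].
  move=> x; rewrite indic_set_bool -expRD.
  case: (leP s (\sum_(t < n) Z t x)) => [sx|_]; last by rewrite /= expR_ge0.
  by rewrite /= -expR0 ler_expR mulNr addrC subr_ge0 ler_wpM2l.
by rewrite RintZ// ler_wpM2l ?expR_ge0//; exact: moment.
Qed.

End exponential_tail.

(** * The null hypothesis *)

Section uniform_law.
Context {R : realType}.
Notation leb := (@lebesgue_measure R).

Lemma lebesgue_itv01 : leb `[0, 1] = 1%E.
Proof. by rewrite lebesgue_measure_itv/= lte_fin ltr01 oppr0 adde0. Qed.

Lemma bmeas_integrable01 {f : R -> R} : bmeas f ->
  leb.-integrable `[0, 1] (EFin \o f).
Proof.
move=> [mf [M fM]]; apply: measurable_bounded_integrable => //.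
- by rewrite [ltLHS]lebesgue_itv01 ltry.
- exact: measurable_funTS.
exists M; split; first by rewrite num_real.
by move=> y My x _; apply: le_trans (fM x) (ltW My).
Qed.

(** The hypothesis [law] says that [X] restricted to the event [D] has [c] times the uniform law.
    The difference of the two sides is a bounded functional of [f] that vanishes on indicators. *)
Lemma uniform_law_Rint {d : measure_display} {T : measurableType d}
    (P : probability T R) (D : set T) (X : T -> R) (c : R) (f : R -> R) :
  measurable D -> measurable_fun setT X -> bmeas f ->
  (forall S : set R, measurable S ->
     P (D `&` X @^-1` S) = (c%:E * leb (S `&` `[0%R, 1%R]))%E) ->
  \int[P]_x (\1_D x * f (X x)) = c * \int[leb]_(y in `[0, 1]) f y.
Proof.
move=> mD mX bf law.
have bm (g : R -> R) : bmeas g -> bmeas (fun x => \1_D x * g (X x)).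
  by move=> bg; apply: bmeasM; [exact: bmeas_indic | exact: bmeas_comp].
pose L (g : R -> R) :=
  \int[P]_x (\1_D x * g (X x)) - c * \int[leb]_(y in `[0, 1]) g y.
apply/eqP; rewrite -subr_eq0; apply/eqP; rewrite -/(L f).
apply: bounded_functional_eq0 bf.
  split.
  - move=> g1 g2 b1 b2; rewrite /L RintegralD//; try exact: bmeas_integrable01.
    under eq_Rintegral do rewrite mulrDr.
    by rewrite RintD; [ring | exact: bm | exact: bm].
  - move=> k g bg; rewrite /L RintegralZl//; last exact: bmeas_integrable01.
    under eq_Rintegral do rewrite mulrCA.
    by rewrite RintZ; [ring | exact: bm].
  - exists (1 + `|c|) => g b bg gb; rewrite mulrDl mul1r.
    apply: le_trans (ler_normB _ _) _; apply: lerD.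
      apply: le_norm_Rint => [|x]; first exact: bm.
      rewrite normrM -[b]mul1r; apply: ler_pM => //.
      by rewrite indicE ger0_norm// lern1; case: (_ \in _).
    rewrite normrM ler_wpM2l//.
    apply: le_trans (le_normr_Rintegral _ (bmeas_integrable01 bg)) _ => //.
    apply: (@le_trans _ _ (\int[leb]_(y in `[0, 1]) b)); last first.
      rewrite Rintegral_cst//.
      by have -> : fine (leb `[0, 1]) = 1; rewrite ?mulr1// lebesgue_itv01.
    apply: le_Rintegral => //.
      by apply: integrable_norm; exact: bmeas_integrable01.
    by apply: bmeas_integrable01; exact: bmeas_cst.
move=> S mS; rewrite /L.
have -> : \int[leb]_(y in `[0, 1]) \1_S y = fine (leb (S `&` `[0, 1])).
  by rewrite /Rintegral integral_indic.
have mXS : measurable (X @^-1` S) by rewrite -[X in measurable X]setTI; exact: mX.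
have -> : \int[P]_x (\1_D x * \1_S (X x)) = \int[P]_x \1_(D `&` X @^-1` S) x.
  by apply: eq_Rintegral => x _; rewrite indicI.
rewrite Rint_indic; last exact: measurableI.
rewrite law// fineM ?subrr// ge0_fin_numE//.
apply: (@le_lt_trans _ _ (leb `[0, 1])); last by rewrite lebesgue_itv01 ltry.
by apply: le_measure; rewrite ?inE//; exact: measurableI.
Qed.

End uniform_law.

(** * The score function extended to the real line by clamping *)

Section score.
Context {R : realType}.
Variable h : R -> R.
Hypothesis hmono : {in `[0, 1] &, {homo h : x y / x <= y}}.

Lemma clamp01_itv (y : R) : clamp01 y \in `[0, 1].
Proof. by rewrite in_itv/= /clamp01 le_min le_max lexx orbT ler01 ge_min lexx orbT. Qed.

Lemma clamp01_id (y : R) : 0 <= y <= 1 -> clamp01 y = y.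
Proof. by move=> /andP[y0 y1]; rewrite /clamp01 (max_idPl y0) (min_idPl y1). Qed.

Lemma le_score (x y : R) : x <= y -> h (clamp01 x) <= h (clamp01 y).
Proof.
move=> xy; apply: hmono; rewrite ?clamp01_itv//.
apply: le_min2; last exact: lexx.
by apply: le_max2.
Qed.

Lemma score_itv (y : R) : h 0 <= h (clamp01 y) <= h 1.
Proof.
have := clamp01_itv y; rewrite in_itv/= => /andP[y0 y1].
by apply/andP; split; apply: hmono; rewrite ?in_itv/= ?lexx ?ler01 ?y0 ?y1.
Qed.

(** Clamping makes the score monotone on the whole line, hence measurable, with values between [h 0]
    and [h 1]. *)
Lemma bmeas_score : bmeas (fun y => h (clamp01 y)).
Proof.
split; first by apply: nondecreasing_measurable => // x y; exact: le_score.
exists (Num.max `|h 0| `|h 1|) => y; have /andP[y0 y1] := score_itv y.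
rewrite le_max; case: (leP 0 (h (clamp01 y))) => s.
  by rewrite ger0_norm// (le_trans y1 (ler_norm _)) orbT.
by rewrite ltr0_norm// -[`|h 0|]normrN (le_trans _ (ler_norm _))// lerN2.
Qed.

Lemma E0_clamp : E0 h = \int[lebesgue_measure]_(y in `[0, 1]) h (clamp01 y).
Proof.
rewrite /E0 -/(Rintegral _ _ _); apply: eq_Rintegral => y.
by rewrite inE/= in_itv/= => y01; rewrite clamp01_id.
Qed.

Lemma E0_itv : h 0 <= E0 h <= h 1.
Proof.
have cst01 (c : R) : \int[lebesgue_measure]_(y in `[0, 1]) c = c.
  rewrite Rintegral_cst//.
  by rewrite (_ : fine _ = 1) ?mulr1// [X in fine X]lebesgue_itv01.
rewrite E0_clamp -[X in X <= _ <= _]cst01 -[X in _ <= _ <= X]cst01.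
have bs := bmeas_integrable01 bmeas_score.
have bc c := bmeas_integrable01 (@bmeas_cst R _ R c).
by apply/andP; split; apply: le_Rintegral => // y _; have /andP[] := score_itv y.
Qed.

Lemma score_dev (y : R) : `|h (clamp01 y) - E0 h| <= h 1 - h 0.
Proof.
have /andP[? ?] := score_itv y; have /andP[? ?] := E0_itv.
by rewrite ler_norml; apply/andP; split; lra.
Qed.

Lemma Th_rejectE (C : R) (a : nat -> R) (n : nat) (y : nat -> R) :
  Th_reject h C a n y =
  (C * Num.sqrt n%:R * a n <= \sum_(t < n) (h (clamp01 (y t)) - E0 h)).
Proof.
by rewrite /Th_reject sumrB sumr_const card_ord lerBrDl mulr_natl.
Qed.

(** * The rejection probability for independent uniform observations *)

Section null.
Context {d : measure_display} {T : measurableType d}.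
Variables (P : probability T R) (n : nat) (Y : nat -> T -> R).
Hypothesis model : H0_model P n Y.

(** A family stable under intersection that generates the past of [Y t]. Rectangles are the events
    on which [H0_model] gives the probability directly. *)
Definition box (t : nat) : set (set T) :=
  [set A | exists E : nat -> set R, (forall s, measurable (E s)) /\
     A = \bigcap_(s in `I_t) (Y s @^-1` E s)].

Let mY t : (t < n)%N -> measurable_fun setT (Y t).
Proof. exact: model.1. Qed.

Lemma box_measurable t : (t < n)%N -> box t `<=` measurable.
Proof.
move=> tn _ [E [mE ->]]; apply: bigcap_measurableType.
move=> s /= st; rewrite -[X in measurable X]setTI.
by apply: mY => //; exact: (ltn_trans st tn).
Qed.

(** Both sides are finite measures in [A]. They agree on rectangles by the product formula, hence on
    the sigma-algebra that rectangles generate. *)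
Lemma box_indep t A (S : set R) : (t < n)%N -> <<s box t >> A -> measurable S ->
  P (A `&` Y t @^-1` S) = ((fine (P A))%:E * lebesgue_measure (S `&` `[0%R, 1%R]))%E.
Proof.
move=> tn bA mS.
have prodE (E : nat -> set R) : (forall s, measurable (E s)) ->
    P (\bigcap_(s in `I_t) (Y s @^-1` E s) `&` Y t @^-1` S) =
    (P (\bigcap_(s in `I_t) (Y s @^-1` E s)) *
     lebesgue_measure (S `&` `[0%R, 1%R]))%E.
  move=> mE.
  (* The product formula concerns all [n] coordinates, so rectangles are padded with the full line;
     [E2] carries [S] at coordinate [t]. *)
  pose E1 s := if (s < t)%N then E s else setT.
  pose E2 s := if s == t then S else E1 s.
  have mE1 s : measurable (E1 s) by rewrite /E1; case: ifP => _; [exact: mE|exact: measurableT].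
  have mE2 s : measurable (E2 s) by rewrite /E2; case: ifP => _; [exact: mS|exact: mE1].
  have -> : \bigcap_(s in `I_t) (Y s @^-1` E s) `&` Y t @^-1` S =
            \bigcap_(s in `I_n) (Y s @^-1` E2 s).
    apply/seteqP; split=> x.
      move=> [EX SX] s /= sn; rewrite /E2 /E1.
      by case: eqP => [->//|_]; case: ifP => // st; exact: EX.
    move=> EX; split; last by have := EX t tn; rewrite /= /E2 eqxx.
    move=> s /= st; have := EX s (ltn_trans st tn).
    by rewrite /= /E2 /E1 st ltn_eqF.
  have -> : \bigcap_(s in `I_t) (Y s @^-1` E s) = \bigcap_(s in `I_n) (Y s @^-1` E1 s).
    apply/seteqP; split=> x.
      by move=> EX s /= sn; rewrite /E1; case: ifP => // st; exact: EX.
    move=> EX s /= st; have := EX s (ltn_trans st tn).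
    by rewrite /= /E1 st.
  rewrite model.2// model.2//.
  pose l := lebesgue_measure (S `&` `[0%R, 1%R]) : \bar R.
  transitivity (\prod_(s < n) (lebesgue_measure (E1 s `&` `[0%R, 1%R]) *
                               (if s == Ordinal tn then l else 1)))%E.
    apply: eq_bigr => s _; rewrite /E2 -(inj_eq val_inj)/=.
    case: eqP => [->|_]; last by rewrite mule1.
    by rewrite /E1 ltnn setTI [X in (X * _)%E]lebesgue_itv01 mul1e.
  by rewrite big_split/= -big_mkcond big_pred1_eq.
have mC : measurable (Y t @^-1` S) by rewrite -[X in measurable X]setTI; exact: mY.
have PC : P (Y t @^-1` S) = lebesgue_measure (S `&` `[0%R, 1%R]).
  have := prodE (fun=> setT) (fun=> measurableT).
  have -> : \bigcap_(s in `I_t) (Y s @^-1` setT) = setT.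
    by apply/seteqP; split => // x _ s _.
  by rewrite setTI probability_setT mul1e.
rewrite -PC.
have c0 : 0 <= fine (P (Y t @^-1` S)) by exact: fine_ge0.
have cE : (fine (P (Y t @^-1` S)))%:E = P (Y t @^-1` S) by rewrite fineK ?fin_num_measure.
have mA : measurable A by exact: (sub_sigma_measurable _ (box_measurable _ tn)).
rewrite fineK ?fin_num_measure// muleC.
pose m1 : {measure set T -> \bar R} := mrestr P mC.
pose m2 : {measure set T -> \bar R} := mscale (NngNum c0) P.
have -> : P (A `&` Y t @^-1` S) = m1 A by [].
have -> : (P (Y t @^-1` S) * P A)%E = m2 A by rewrite /m2 /= /mscale /= cE.
apply: (g_sigma_algebra_measure_unique (box t) (box_measurable _ tn) (fun=> setT)) => //.
- by move=> _; exists (fun=> setT); split=> //; apply/seteqP; split.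
- by rewrite bigcup_const.
- move=> _ _ [E [mE ->]] [F [mF ->]]; exists (fun s => E s `&` F s); split.
    by move=> s; exact: measurableI.
  by rewrite -bigcapI.
- move=> _ [E [mE ->]]; rewrite /m1 /m2 /= /mscale /mrestr/= prodE//.
  by rewrite cE PC muleC.
- move=> _; rewrite /m1 /= /mrestr setTI.
  by rewrite (le_lt_trans (probability_le1 P mC)) ?ltry.
Qed.

Lemma null_tail (C : R) (a : nat -> R) (lam : R) :
  0 <= lam -> lam * (h 1 - h 0) <= 1 / 2 ->
  fine (P [set x | Th_reject h C a n (fun t => Y t x)]) <=
  expR (- lam * (C * Num.sqrt n%:R * a n) +
        n%:R * (2 * (lam * (h 1 - h 0)) ^+ 2)).
Proof.
move=> lam0 lamM.
have -> : [set x | Th_reject h C a n (fun t => Y t x)] =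
  [set x | C * Num.sqrt n%:R * a n <= \sum_(t < n) (h (clamp01 (Y t x)) - E0 h)].
  by apply/funext => x /=; rewrite Th_rejectE.
(* This puts the exponent in the shape of the tail bound with [delta] equal to 0: the centred score
   has conditional mean 0. *)
rewrite -[2 * _]add0r -[X in X + 2 * _](mulr0 lam).
have bs := bmeas_score.
apply: (exponential_tail_bound P n box (fun t x => h (clamp01 (Y t x)) - E0 h)) => //.
- exact: box_measurable.
- move=> t tn; apply: (@bmeas_comp _ _ _ _ _ (fun y => h (clamp01 y) - E0 h) _ (mY _ tn) _).1.
  by apply: bmeasB => //; exact: bmeas_cst.
- move=> k t /andP[kt tn].
  have mYk : measurable_fun [set: g_sigma_algebraType (box t)] (Y k).
    move=> _ B mB; rewrite setTI; apply: sub_sigma_algebra.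
    exists (fun s => if s == k then B else setT); split; first by move=> s; case: ifP.
    apply/seteqP; split=> x; last by move=> /(_ k kt)/=; rewrite eqxx.
    by move=> Bx s /= _; case: eqP => // ->.
  apply: (@bmeas_comp _ _ _ _ _ (fun y => h (clamp01 y) - E0 h) _ mYk _).1.
  by apply: bmeasB => //; exact: bmeas_cst.
- by move=> t x _; exact: score_dev.
- move=> t A tn GA.
  have mA : measurable A by exact: (sub_sigma_measurable _ (box_measurable _ tn)).
  rewrite mul0r le_eqVlt; apply/orP; left; apply/eqP.
  have bY : bmeas (fun x => \1_A x * h (clamp01 (Y t x))).
    by apply: bmeasM; [exact: bmeas_indic|exact: (bmeas_comp _ _ (mY _ tn) bs)].
  under eq_Rintegral do rewrite mulrBr [_ * E0 h]mulrC.
  rewrite RintB// ?RintZ//; try (by apply: bmeasZ; exact: bmeas_indic).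
    rewrite Rint_indic//.
    rewrite (uniform_law_Rint _ _ _ _ _ mA (mY _ tn) bs (fun S => box_indep _ _ S tn GA)).
    by rewrite -E0_clamp mulrC subrr.
  exact: bmeas_indic.
Qed.

End null.
End score.

(** * Gumbel-max tokens *)

Section gumbel_max.
Context {R : realType} {W : finType}.
Variables (p u : W -> R) (D : R).
Hypotheses (pv : prob_vector p) (DE : Delta p = D).
Notation N := (#|W|%:R : R).

Lemma prob_vector_card_gt0 : 0 < N.
Proof.
rewrite ltr0n lt0n; apply/eqP => W0; have := pv.2.
rewrite big_pred0; last by move=> w; have := fintype0 w W0.
by move=> /eqP; rewrite eq_sym oner_eq0.
Qed.

Lemma Delta_max w : p w <= 1 - D.
Proof. by rewrite -DE /Delta subKr; exact: le_bigmax. Qed.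

Lemma Delta_argmax : exists v, p v = 1 - D.
Proof.
have [w _] : exists w : W, w \in W.
  by apply/card_gt0P; have := prob_vector_card_gt0; rewrite ltr0n.
(* The maximum in [Delta] has default value 0. It is still attained at a token, since [W] is
   inhabited and the probabilities are nonnegative. *)
have [v _ vE] := @eq_bigmax _ R W 0 w predT p isT (fun i _ => pv.1 i).
by exists v; rewrite -DE /Delta subKr.
Qed.

(** The largest probability is at least the average $1/N$. *)
Lemma Delta_card : 1 <= N * (1 - D).
Proof.
rewrite -[leLHS]pv.2 mulr_natl -sumr_const.
by apply: ler_sum => w _; exact: Delta_max.
Qed.

Lemma sum_nonmax v : p v = 1 - D -> \sum_(w | w != v) p w = D.
Proof. by move=> pvE; have := pv.2; rewrite (bigD1 v)//= pvE; lra. Qed.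

Lemma le_nonmax v w : p v = 1 - D -> w != v -> p w <= D.
Proof.
move=> /sum_nonmax <- wv; rewrite (bigD1 w)//= lerDl.
by apply: sumr_ge0 => i _; exact: pv.1.
Qed.

(** The $N - 1$ tokens other than $v$ share the mass $D$. Were each below $D/N$, their total would
    be at most $D - D/N < D$. *)
Lemma Delta_runner_up v : 0 < D -> p v = 1 - D ->
  exists2 w, w != v & D / N <= p w.
Proof.
move=> D0 pvE; apply: contrapT => no.
have lt w : w != v -> p w <= D / N.
  move=> wv; rewrite leNgt; apply/negP => /ltW h; apply: no; by exists w.
have N0 := prob_vector_card_gt0.
have : \sum_(w | w != v) p w <= \sum_(w | w != v) D / N by exact: ler_sum.
have : D / N + \sum_(w | w != v) D / N = D.
  rewrite -(bigD1 v (P := predT) (F := fun=> D / N))//=.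
  by rewrite sumr_const -(mulr_natr (D / N)) -mulrA mulVf ?mulr1// gt_eqF.
have : 0 < D / N by rewrite divr_gt0.
by rewrite (sum_nonmax _ pvE); lra.
Qed.

Hypothesis u01 : forall w, 0 < u w <= 1.
Variables v w : W.
Hypotheses (pvE : p v = 1 - D) (max_w : is_gumbel_max p u w).

Let pv0 : 0 < p v.
Proof.
have := Delta_card; rewrite -pvE => h.
rewrite -(pmulr_rgt0 _ prob_vector_card_gt0); exact: lt_le_trans h.
Qed.

(** The modal token has positive probability, so its score is finite and the maximiser cannot have
    score $-\infty$. *)
Lemma gumbel_max_ln : 0 < p w /\ ln (u v) / p v * p w <= ln (u w).
Proof.
have := max_w v; rewrite /gumbel_score pv0.
have [pw|_] := ltP 0 (p w); last by rewrite leeNy_eq.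
by rewrite lee_fin => h; split=> //; rewrite -ler_pdivlMr.
Qed.

Let lnu_le0 i : ln (u i) <= 0.
Proof. by have /andP[_ h] := u01 i; exact: ln_le0. Qed.

Let u_pos i : u i \is Num.pos.
Proof. by rewrite posrE; have /andP[] := u01 i. Qed.

(** Logarithms are at most 0 and $p_w \le p_v$, so $\ln u_w \ge (p_w / p_v) \ln u_v \ge \ln u_v$. *)
Lemma gumbel_max_ge : u v <= u w.
Proof.
rewrite -ler_ln//; have [pw0 h] := gumbel_max_ln; apply: le_trans h.
have pwv : p w <= p v by rewrite pvE; exact: Delta_max.
rewrite -mulrA -[leLHS]mulr1 ler_wnM2l// mulrC ler_pdivrMr// mul1r//.
Qed.

(** Here $p_w / p_v \le D / (1 - D) \le N D$, so $\ln u_w \ge N D \ln u_v$, and $e^y \ge 1 + y$. *)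
Lemma gumbel_max_near1 : 0 < D -> w != v -> 1 + N * D * ln (u v) <= u w.
Proof.
move=> D0 wv; rewrite -[u w]lnK//.
have [pw0 h] := gumbel_max_ln.
apply: le_trans (expR_ge1Dx _) _; rewrite ler_expR; apply: le_trans h.
rewrite [N * D * _]mulrC [ln (u v) / p v * p w]mulrAC -[ln (u v) * p w / p v]mulrA.
rewrite ler_wnM2l// ler_pdivrMr//.
apply: le_trans (le_nonmax _ _ pvE wv) _.
rewrite mulrAC -[leLHS]mul1r ler_wpM2r//; first exact: ltW.
by rewrite pvE Delta_card.
Qed.

(** If [v] were selected, then $\ln u_i \le p_i \ln u_v / p_v \le (D/N) \ln x_0 < (D/N) \ln x_1 \le
    \ln u_i$. *)
Lemma gumbel_max_neq (i : W) (x0 x1 : R) : 0 < D -> 0 < x0 < x1 -> x1 < 1 ->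
  D / N <= p i -> u v <= x0 -> expR (D / N * ln x1) <= u i -> w != v.
Proof.
move=> D0 /andP[x00 x01] x11 pi uv ui; apply/eqP => wv.
have x10 : 0 < x1 by exact: lt_trans x01.
have DN : 0 < D / N by rewrite divr_gt0// prob_vector_card_gt0.
have pi0 : 0 < p i by exact: lt_le_trans pi.
have pv1 : p v <= 1 by rewrite pvE; lra.
have := max_w i; rewrite wv /gumbel_score pv0 pi0 lee_fin.
rewrite ler_pdivrMr// => h1.
have h2 : D / N * ln x1 <= ln (u i) by rewrite -[leLHS]expRK ler_ln// posrE expR_gt0.
have lx0 : ln (u v) <= ln x0 by rewrite ler_ln// posrE.
have lx01 : ln x0 < ln x1 by rewrite ltr_ln// posrE.
have lx1 : ln x1 < 0 by apply: ln_lt0; rewrite x10.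
have h3 : ln (u v) / p v <= ln x0.
  rewrite ler_pdivrMr//; apply: le_trans lx0 _.
  by rewrite -[leLHS]mulr1 ler_wnM2l// ltW// (lt_trans lx01).
have h4 : ln (u v) / p v * p i <= ln x0 * (D / N).
  apply: (@le_trans _ _ (ln x0 * p i)); first by rewrite ler_wpM2r// ltW.
  by rewrite ler_wnM2l// ltW// (lt_trans lx01).
have h5 : ln x0 * (D / N) < ln x1 * (D / N) by rewrite ltr_pM2r.
by move: h1 h2 h4 h5; lra.
Qed.

End gumbel_max.

(** * Conditional drift of one token *)

(** Since $e \ge 2$, the sum is dominated by $\sum_k (k+1) 2^{-k}$, whose partial sums have a closed
    form below 4. *)
Lemma sum_succ_expN_le4 {R : realType} (K : nat) :
  \sum_(k < K) k.+1%:R * expR (- k%:R) <= 4 :> R.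
Proof.
have e2 : (2 : R) <= expR 1 by have := expR_ge1Dx (1 : R); lra.
have eN k : expR (- k%:R) <= (2 ^- k : R).
  rewrite expRN lef_pV2 ?posrE ?expR_gt0 ?exprn_gt0//.
  by rewrite -[k%:R]mulr1 expRM_natl lerXn2r// nnegrE ?expR_ge0.
suff : \sum_(k < K) k.+1%:R * (2 ^- k : R) = 4 - (K%:R + 2) * 2 * 2 ^- K.
  move=> sE; apply: (@le_trans _ _ (\sum_(k < K) k.+1%:R * (2 ^- k : R))).
    by apply: ler_sum => k _; rewrite ler_wpM2l.
  rewrite sE lerBlDr lerDl; apply: mulr_ge0; last by rewrite invr_ge0 exprn_ge0.
  by apply: mulr_ge0 => //; exact: addr_ge0.
elim: K => [|K IH]; first by rewrite big_ord0 expr0 invr1; ring.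
rewrite big_ord_recr/= IH exprS -[K.+1%:R]natr1.
by field; rewrite expf_neq0.
Qed.

Lemma integer_part_or_large {R : realType} (y : R) (K : nat) : 0 <= y ->
  K%:R <= y \/ exists2 k : 'I_K, k%:R <= y & y < k.+1%:R.
Proof.
move=> y0; elim: K => [|K [IH|[k ky yk]]]; first by left.
  have [KS|yK] := leP K.+1%:R y; first by left.
  by right; exists ord_max.
by right; exists (widen_ord (leqnSn K) k).
Qed.

Section finite_cover.
Context {R : realType} {d : measure_display} {T : measurableType d}.
Variables (P : probability T R) (F : set (set T)).
Hypothesis Fm : F `<=` measurable.

(** A drift bound may be proved separately on each piece of a cover known from the past, for
    instance with the modal token fixed. Overlaps are removed by subtracting the pieces one at a
    time. *)
Lemma finite_cover_Rint_le (I : finType) (Cs : I -> set T) (Z : T -> R) (delta : R) :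
  bmeas Z -> (forall i, <<s F >> (Cs i)) -> (forall x, exists i, Cs i x) ->
  (forall i A, <<s F >> A -> A `<=` Cs i ->
     \int[P]_x (\1_A x * Z x) <= delta * fine (P A)) ->
  forall A, <<s F >> A -> \int[P]_x (\1_A x * Z x) <= delta * fine (P A).
Proof.
move=> bZ FC cov piece.
have mF := sub_sigma_measurable _ Fm.
suff gen (s : seq I) : forall A, <<s F >> A ->
    (forall x, A x -> exists2 i, i \in s & Cs i x) ->
    \int[P]_x (\1_A x * Z x) <= delta * fine (P A).
  move=> A FA; apply: (gen (enum I)) => // x _; have [i Ci] := cov x.
  by exists i => //; rewrite mem_enum.
elim: s => [|i s IH] A FA As.
  have -> : A = set0 by apply/seteqP; split=> // x /As[j]; rewrite in_nil.
  rewrite measure0 mulr0; under eq_Rintegral do rewrite indic0 mul0r.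
  by rewrite Rint_cst.
pose A1 := A `&` Cs i; pose A2 := A `\` Cs i.
have FA1 : <<s F >> A1 by apply: (@measurableI _ (g_sigma_algebraType F)); [exact: FA|exact: FC].
have FA2 : <<s F >> A2 by apply: (@measurableD _ (g_sigma_algebraType F)); [exact: FA|exact: FC].
have indE x : \1_A x = \1_A1 x + \1_A2 x :> R.
  rewrite !indicE /A1 /A2 in_setI in_setD.
  by case: (x \in A); case: (x \in Cs i); rewrite /= ?addr0 ?add0r.
have PE : fine (P A) = fine (P A1) + fine (P A2).
  rewrite -!Rint_indic; try exact: mF.
  rewrite -RintD; try (by apply: bmeas_indic; exact: mF).
  by apply: eq_Rintegral => x _; rewrite indE.
under eq_Rintegral do rewrite indE mulrDl.
rewrite RintD; try (by apply: bmeasM => //; apply: bmeas_indic; exact: mF).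
rewrite PE mulrDr lerD//; first by apply: (piece i) => // x [].
apply: IH => // x [Ax Cx]; have [j js Cj] := As _ Ax.
by exists j => //; move: js; rewrite inE => /predU1P[ji|//]; rewrite ji in Cj.
Qed.

End finite_cover.

Lemma indic_le1 {R : realType} {T : Type} (A : set T) (x : T) : 0 <= (\1_A x : R) <= 1.
Proof. by rewrite indicE; case: (_ \in _); rewrite /= ?lexx ?ler01. Qed.

Lemma Rint_setE {R : realType} {d : measure_display} {T : measurableType d}
    (P : probability T R) (A : set T) (g : T -> R) : measurable A -> bmeas g ->
  (\int[P]_(x in A) (g x)%:E)%E = (\int[P]_x (\1_A x * g x))%:E.
Proof.
move=> mA bg; rewrite /Rintegral fineK.
  rewrite [LHS]integral_mkcond; apply: eq_integral => x _.
  by rewrite patchE indicE; case: ifP => _; rewrite ?mul1r ?mul0r.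
apply: integrable_fin_num => //.
by apply: (bmeas_integrable P); apply: bmeasM => //; exact: bmeas_indic.
Qed.

Section one_step.
Context {R : realType} {W : finType} {d : measure_display} {T : measurableType d}.
Variables (P : probability T R) (eps D : R) (F X : set (set T)).
Variables (p U : W -> T -> R) (tok : T -> W) (B : T -> bool).
Variable h : R -> R.
Hypothesis hmono : {in `[0, 1] &, {homo h : x y / x <= y}}.
Hypotheses (Fm : F `<=` measurable) (Xm : X `<=` measurable).
Hypothesis pF : forall w (S : set R), measurable S -> F (p w @^-1` S).
Hypothesis UX : forall w (S : set R), measurable S -> X (U w @^-1` S).
Hypothesis mtok : forall w, measurable (tok @^-1` [set w]).
Hypothesis mB : measurable [set x | B x].
Hypothesis pvD : forall x, prob_vector (p ^~ x) /\ Delta (p ^~ x) = D.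
Hypothesis unif : forall w, uniform01_law P (U w).
Hypothesis prodU : forall E : W -> set R, (forall w, measurable (E w)) ->
  P (\bigcap_(w in [set: W]) (U w @^-1` E w)) = (\prod_(w : W) P (U w @^-1` E w))%E.
Hypothesis wm : forall A E, <<s F >> A -> <<s X >> E ->
  P (A `&` E `&` [set x | B x]) = (eps%:E * P A * P E)%E.
Hypothesis amax : forall x, B x -> is_gumbel_max (p ^~ x) (U ^~ x) (tok x).
Hypothesis nonwm : forall A E w, <<s F >> A -> <<s X >> E ->
  P (A `&` E `&` [set x | ~~ B x] `&` tok @^-1` [set w]) =
  ((1 - eps)%:E * (\int[P]_(x in A) (p w x)%:E) * P E)%E.
Hypotheses (D0 : 0 < D) (eps0 : 0 <= eps).

Notation leb := (@lebesgue_measure R).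
Notation N := (#|W|%:R : R).
Notation M := (h 1 - h 0).
Notation pr A := (fine (P A)).
Notation fh y := (h (clamp01 y)).
Notation Y x := (U (tok x) x).

Let mF := sub_sigma_measurable _ Fm.
Let mX := sub_sigma_measurable _ Xm.
Let sX w (S : set R) : measurable S -> <<s X >> (U w @^-1` S).
Proof. by move=> mS; apply: sub_sigma_algebra; exact: UX. Qed.

Let mU w : measurable_fun setT (U w).
Proof. by move=> _ S mS; rewrite setTI; apply: mX; exact: sX. Qed.

Let bp w : bmeas (p w).
Proof.
split; first by move=> _ S mS; rewrite setTI; apply: mF; apply: sub_sigma_algebra; exact: pF.
exists 1 => x; have [[p0 p1] _] := pvD x; rewrite ger0_norm// -p1 (bigD1 w)//= lerDl.
exact: sumr_ge0.
Qed.

Let bfh := bmeas_score _ hmono.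

Let bfU w : bmeas (fun x => fh (U w x)).
Proof. exact: (bmeas_comp _ _ (mU w) bfh). Qed.

Let mNB : measurable [set x | ~~ B x].
Proof.
rewrite (_ : [set x | ~~ B x] = ~` [set x | B x]); first exact: measurableC.
by apply/seteqP; split=> x /= => [/negP|/negP].
Qed.

(** The randomly indexed uniform becomes a finite sum over fixed indices, to which measurability and
    the law of each [U w] apply. *)
Lemma token_sum (f : R -> R) x :
  f (Y x) = \sum_w \1_(tok @^-1` [set w]) x * f (U w x).
Proof.
rewrite (bigD1 (tok x))//= big1 ?addr0.
  by rewrite indicE mem_set ?mul1r.
move=> w wt; rewrite indicE memNset ?mul0r//= => tw.
by move: wt; rewrite tw eqxx.
Qed.

Lemma bmeas_token : bmeas (fun x => fh (Y x)).
Proof.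
under eq_fun do rewrite (token_sum (fun y => fh y)).
by apply: bmeas_sum => w; apply: bmeasM; [exact: bmeas_indic | exact: bfU].
Qed.

(** On the event that the unwatermarked token is [w], the variable [U w] keeps a uniform law, with
    mass $(1 - \varepsilon) E[1_A P_w]$. Summing over [w] uses $\sum_w P_w = 1$. *)
Lemma unwatermarked_Rint A : <<s F >> A ->
  \int[P]_x (\1_(A `&` [set x | ~~ B x]) x * fh (Y x)) = (1 - eps) * pr A * E0 h.
Proof.
move=> FA; have mA := mF _ FA.
pose Dw w := A `&` [set x | ~~ B x] `&` tok @^-1` [set w].
have mD w : measurable (Dw w) by apply: measurableI => //; exact: measurableI.
have law w (S : set R) : measurable S ->
    P (Dw w `&` U w @^-1` S) =
    (((1 - eps) * \int[P]_x (\1_A x * p w x))%:E * leb (S `&` `[0%R, 1%R]))%E.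
  move=> mS; have <- := unif w S mS.
  have := nonwm A (U w @^-1` S) w FA (sX w S mS).
  rewrite Rint_setE// -EFinM => <-; congr (P _).
  by apply/seteqP; split=> x; rewrite /Dw /=; tauto.
transitivity (\sum_w \int[P]_x (\1_(Dw w) x * fh (U w x))).
  rewrite -Rint_sum; last first.
    by move=> w; apply: bmeasM => //; exact: bmeas_indic.
  apply: eq_Rintegral => x _; rewrite (token_sum (fun y => fh y)) mulr_sumr.
  by apply: eq_bigr => w _; rewrite mulrA /Dw [in RHS]indicI.
under eq_bigr do rewrite (uniform_law_Rint _ _ _ _ _ (mD _) (mU _) bfh (law _)) -E0_clamp -mulrA.
rewrite -mulr_sumr -mulr_suml mulrA; congr (_ * _ * _).
rewrite -Rint_sum; last by move=> w; apply: bmeasM => //; exact: bmeas_indic.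
rewrite -Rint_indic//; apply: eq_Rintegral => x _.
by rewrite -mulr_sumr (pvD x).1.2 mulr1.
Qed.

(** This concerns a fixed token [v]: watermarking is independent of the past and of the uniforms, so
    it leaves [U v] uniform. It is the reference with which the selected uniform is compared. *)
Lemma watermarked_Rint A v : <<s F >> A ->
  \int[P]_x (\1_(A `&` [set x | B x]) x * fh (U v x)) = eps * pr A * E0 h.
Proof.
move=> FA; have mA := mF _ FA; rewrite E0_clamp.
apply: uniform_law_Rint => //; first exact: measurableI.
move=> S mS; have <- := unif v S mS.
have := wm A (U v @^-1` S) FA (sX v S mS).
rewrite -setIA [X in _ `&` X]setIC setIA => ->.
by rewrite EFinM fineK// fin_num_measure.
Qed.

Lemma watermarked_indic A E : <<s F >> A -> <<s X >> E ->
  \int[P]_x (\1_(A `&` [set x | B x]) x * \1_E x) = eps * pr A * pr E.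
Proof.
move=> FA XE; have mA := mF _ FA; have mE := mX _ XE.
have -> : \int[P]_x (\1_(A `&` [set x | B x]) x * \1_E x) =
    \int[P]_x (\1_(A `&` E `&` [set x | B x]) x).
  by apply: eq_Rintegral => x _; rewrite !indicI/= mulrAC.
rewrite Rint_indic; last by apply: measurableI => //; exact: measurableI.
rewrite wm// fineM ?fin_num_measure// ?fineM ?fin_num_measure//.
by rewrite fin_numM// fin_num_measure.
Qed.

Lemma box_sigma (E : W -> set R) : (forall w, measurable (E w)) ->
  <<s X >> (\bigcap_(w in [set: W]) (U w @^-1` E w)).
Proof.
move=> mE; apply: (@fin_bigcap_measurable _ (g_sigma_algebraType X)) => // w _.
by apply: sX.
Qed.

Lemma pr_box (E : W -> set R) : (forall w, measurable (E w)) ->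
  pr (\bigcap_(w in [set: W]) (U w @^-1` E w)) = \prod_w pr (U w @^-1` E w).
Proof.
move=> mE; rewrite prodU//.
have fE w : P (U w @^-1` E w) = (pr (U w @^-1` E w))%:E.
  by rewrite fineK// fin_num_measure//; apply: mX; exact: sX.
by rewrite (eq_bigr _ (fun w _ => fE w)) prodEFin.
Qed.

Lemma pr_le w c : 0 <= c <= 1 -> pr (U w @^-1` `]-oo, c]) = c.
Proof.
move=> /andP[c0 c1]; rewrite unif//.
have -> : `]-oo, c]%classic `&` `[0, 1] = `[0, c]%classic.
  apply/seteqP; split=> y /=; rewrite !in_itv/=; first by move=> [-> /andP[->]].
  by move=> /andP[y0 yc]; rewrite y0 yc (le_trans yc c1).
rewrite lebesgue_measure_itv/= lte_fin; case: ltP => [_|]; first by rewrite oppr0 addr0.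
by move=> c0'; apply/eqP; rewrite eq_le c0 c0'.
Qed.

Lemma pr_ge w c : 0 <= c <= 1 -> pr (U w @^-1` `[c, +oo[) = 1 - c.
Proof.
move=> /andP[c0 c1]; rewrite unif//.
have -> : `[c, +oo[%classic `&` `[0, 1] = `[c, 1]%classic.
  apply/seteqP; split=> y /=; rewrite !in_itv/= ?andbT; first by move=> [-> /andP[_ ->]].
  by move=> /andP[cy y1]; rewrite y1 cy (le_trans c0 cy).
rewrite lebesgue_measure_itv/= lte_fin; case: ltP => // c1'.
by apply/esym/eqP; rewrite subr_eq0 eq_le c1 c1'.
Qed.

Lemma pr_near1 w r : 0 <= r -> pr (U w @^-1` `[1 - r, +oo[) <= r.
Proof.
move=> r0; have [r1|r1] := leP r 1; first by rewrite pr_ge ?subKr//; lra.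
have mS : measurable (U w @^-1` `[1 - r, +oo[) by apply: mX; exact: sX.
apply: le_trans (ltW r1); rewrite -lee_fin fineK ?fin_num_measure//.
exact: probability_le1.
Qed.

Lemma pr_pair v w S1 S2 : v != w -> measurable S1 -> measurable S2 ->
  pr (U v @^-1` S1 `&` U w @^-1` S2) = pr (U v @^-1` S1) * pr (U w @^-1` S2).
Proof.
move=> vw m1 m2.
pose E i := if i == v then S1 else if i == w then S2 else setT.
have mE i : measurable (E i).
  by rewrite /E; case: ifP => _ //; case: ifP => _ //; exact: measurableT.
have -> : U v @^-1` S1 `&` U w @^-1` S2 = \bigcap_(i in [set: W]) (U i @^-1` E i).
  apply/seteqP; split=> x.
    by move=> [x1 x2] i _; rewrite /= /E; case: eqP => [->//|_]; case: eqP => [->//|].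
  move=> h'; split; first by have := h' v I; rewrite /= /E eqxx.
  by have := h' w I; rewrite /= /E eqxx eq_sym (negbTE vw).
rewrite pr_box// (bigD1 v)//= (bigD1 w) 1?eq_sym//= mulrA big1 ?mulr1.
  by rewrite /E eqxx [w == v]eq_sym (negbTE vw) eqxx.
move=> i /andP[iv iw]; rewrite /E (negbTE iv) (negbTE iw) preimage_setT.
by rewrite probability_setT.
Qed.

(** The almost sure event on which every logarithm is taken at a point of $(0,1]$, as the Gumbel-max
    inequalities require. *)
Definition unit_cube := \bigcap_(w in [set: W]) (U w @^-1` `]0, 1]).

Lemma unit_cubeP x : unit_cube x -> forall w, 0 < U w x <= 1.
Proof. by move=> cx w; have := cx w I; rewrite /= in_itv. Qed.

Lemma unit_cube_sigma : <<s X >> unit_cube.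
Proof. by apply: box_sigma. Qed.

Lemma pr_unit_cubeC : pr (~` unit_cube) = 0.
Proof.
have m1 := mX _ unit_cube_sigma.
rewrite probability_setC// fineB ?fin_num_measure//.
rewrite [fine 1]/= (_ : pr unit_cube = 1) ?subrr//.
rewrite pr_box//; apply: big1 => w _; rewrite unif// (_ : _ `&` _ = `]0, 1]%classic).
  by rewrite lebesgue_measure_itv/= lte_fin ltr01 oppr0 addr0.
apply: setIidl => y /=; rewrite !in_itv/= => /andP[y0 ->].
by rewrite ltW.
Qed.

Lemma unit_cubeC_sigma : <<s X >> (~` unit_cube).
Proof. exact: (@measurableC _ (g_sigma_algebraType X) _ unit_cube_sigma). Qed.


(** Inequalities between [D] and [N] alone are read off at an arbitrary outcome. *)
Let pv0 : prob_vector (p ^~ point) := (pvD point).1.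
Let DE0 : Delta (p ^~ point) = D := (pvD point).2.
Let N0 : 0 < N := prob_vector_card_gt0 _ pv0.

Let DN1 : D / N <= 1.
Proof.
have N1 : 1 <= N by rewrite ler1n -(ltr0n R).
have hD : D < 1.
  have := Delta_card _ _ pv0 DE0; move=> /(lt_le_trans ltr01).
  by rewrite pmulr_rgt0// subr_gt0.
by rewrite ler_pdivrMr// mul1r (le_trans (ltW hD)).
Qed.

Let mM : 0 <= M.
Proof. by have /andP[u v] := score_itv _ hmono 0; rewrite subr_ge0 (le_trans u v). Qed.

(** The unwatermarked half contributes exactly its share of [E0 h], which cancels in the
    centring. *)
Lemma Rint_split A : <<s F >> A ->
  \int[P]_x (\1_A x * (fh (Y x) - E0 h)) =
  \int[P]_x (\1_(A `&` [set x | B x]) x * fh (Y x)) - eps * pr A * E0 h.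
Proof.
move=> FA; have mA := mF _ FA; have bY := bmeas_token.
have bI (C : set T) : measurable C -> bmeas (fun x => \1_C x * fh (Y x)).
  by move=> mC; apply: bmeasM => //; exact: bmeas_indic.
have mAB : measurable (A `&` [set x | B x]) by exact: measurableI.
have mANB : measurable (A `&` [set x | ~~ B x]) by exact: measurableI.
transitivity (\int[P]_x (\1_(A `&` [set x | B x]) x * fh (Y x) +
    \1_(A `&` [set x | ~~ B x]) x * fh (Y x) - E0 h * \1_A x)).
  apply: eq_Rintegral => x _; rewrite !indicI/= !indic_set_bool.
  by case: (B x) => /=; ring.
rewrite RintB; [|exact: bmeasD (bI _ mAB) (bI _ mANB)|by apply: bmeasZ; exact: bmeas_indic].
rewrite RintD ?RintZ ?Rint_indic ?unwatermarked_Rint//; try exact: bI.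
- ring.
- exact: bmeas_indic.
Qed.

(** * Lower bound on the drift of a watermarked token *)

Section gain.
Variables x0 x1 : R.
Hypotheses (x0_gt0 : 0 < x0) (x01 : x0 < x1) (x1_lt1 : x1 < 1).

(** A lower bound, per unit of [D], for the probability of the favourable box. The factors account
    for the modal token, the runner-up and the remaining tokens. *)
Definition gain : R := x0 * (- ln x1 / (1 - ln x1) / N) * (1 - x1) ^+ #|W|.

Let lx1 : ln x1 < 0.
Proof. by apply: ln_lt0; rewrite x1_lt1 (lt_trans x0_gt0). Qed.

Let x1_gt0 : 0 < x1 := lt_trans x0_gt0 x01.
Let x0_lt1 : x0 < 1 := lt_trans x01 x1_lt1.

Let x0_itv : 0 <= x0 <= 1.
Proof. by rewrite !ltW. Qed.

Let x1_itv : 0 <= x1 <= 1.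
Proof. by rewrite !ltW. Qed.

Let kap0 : 0 <= h x1 - h x0.
Proof. by rewrite subr_ge0; apply: hmono; rewrite ?in_itv//= ltW. Qed.

Let kapM : h x1 - h x0 <= M.
Proof.
have h1 : h x1 <= h 1 by apply: hmono; rewrite ?in_itv/= ?ler01 ?lexx// ltW.
have h0 : h 0 <= h x0 by apply: hmono; rewrite ?in_itv/= ?ler01 ?lexx// ltW.
by lra.
Qed.

(** This is $x_1^{D/N}$, the level of the runner-up's uniform above which the modal token loses. *)
Let tau : R := expR (D / N * ln x1).

Let tau_ge : x1 <= tau.
Proof.
have x10 : 0 < x1 by exact: lt_trans x01.
rewrite -[leLHS]lnK// ler_expR -[leLHS]mul1r.
by rewrite ler_wnM2r// ltW.
Qed.

Let tau_le1 : tau <= 1.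
Proof. by rewrite expR_le1 mulr_ge0_le0 ?ltW// divr_gt0. Qed.

(** With $y = -(D/N) \ln x_1$ one has $1 - e^{-y} \ge y / (1 + y)$, and $y \le -\ln x_1$ because
    $D/N \le 1$. *)
Let tau_gap : D / N * (- ln x1 / (1 - ln x1)) <= 1 - tau.
Proof.
set y := D / N * - ln x1.
have y0 : 0 <= y by rewrite mulr_ge0 ?oppr_ge0 ?ltW// divr_gt0.
have -> : tau = (expR y)^-1 by rewrite -expRN /tau /y mulrN opprK.
have hy : (expR y)^-1 <= (1 + y)^-1.
  by rewrite lef_pV2 ?posrE ?expR_gt0 ?expR_ge1Dx//; lra.
apply: (@le_trans _ _ (1 - (1 + y)^-1)); last by rewrite lerD2l lerN2.
have -> : 1 - (1 + y)^-1 = y / (1 + y) by field; lra.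
rewrite mulrA -/y ler_wpM2l// lef_pV2 ?posrE.
- by rewrite lerD2l /y -[leRHS]mul1r ler_wpM2r// oppr_ge0 ltW.
- by rewrite subr_gt0 (lt_trans lx1).
- by rewrite ltr_wpDr.
Qed.

(** On the box the modal token loses and every other uniform is at least [x1], while [U v] is at
    most [x0]; the score rises by at least [h x1 - h x0]. Off the box the selected uniform still
    dominates [U v]. *)
Lemma gain_piece A v i : <<s F >> A -> i != v ->
  (forall x, A x -> p v x = 1 - D /\ D / N <= p i x) ->
  eps * pr A * (E0 h + (h x1 - h x0) * (gain * D)) <=
  \int[P]_x (\1_(A `&` [set x | B x]) x * fh (Y x)).
Proof.
move=> FA iv Avi; have mA := mF _ FA.
pose E w : set R := if w == v then `]-oo, x0]%classic else
  if w == i then `[tau, +oo[%classic else `[x1, +oo[%classic.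
have mE w : measurable (E w) by rewrite /E; case: ifP => _ //; case: ifP.
pose G := \bigcap_(w in [set: W]) (U w @^-1` E w).
have XG : <<s X >> G by exact: box_sigma.
have tau0 : 0 <= tau by exact: expR_ge0.
have prG : gain * D <= pr G.
  rewrite pr_box// (bigD1 v)//= (bigD1 i)//= mulrA.
  rewrite {1 2}/E eqxx (negbTE iv) eqxx pr_le// pr_ge ?tau0//.
  have -> : gain * D = x0 * (D / N * (- ln x1 / (1 - ln x1))) * (1 - x1) ^+ #|W|.
    by rewrite /gain; ring.
  apply: ler_pM.
  - apply: mulr_ge0; first exact: ltW.
    apply: mulr_ge0; first by rewrite divr_ge0 ?ltW.
    by rewrite divr_ge0 ?oppr_ge0 ?ltW// subr_gt0 (lt_trans lx1).
  - by rewrite exprn_ge0// subr_ge0 ltW.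
  - by rewrite ler_wpM2l// ltW.
  rewrite (eq_bigr (fun=> 1 - x1)); last first.
    move=> w /andP[wv wi]; by rewrite /E (negbTE wv) (negbTE wi) pr_ge.
  (* Fewer than [#|W|] factors $1 - x_1 \le 1$ remain, so raising the exponent to [#|W|] only lowers
     the product. *)
  have /andP[? ?] : 0 <= 1 - x1 <= 1 by rewrite subr_ge0 lerBlDr lerDl !ltW.
  by rewrite prodr_const ler_wiXn2l ?max_card.
have mG := mX _ XG; have mC := mX _ unit_cubeC_sigma.
have mAB : measurable (A `&` [set x | B x]) by exact: measurableI.
pose IAB x : R := \1_(A `&` [set x | B x]) x.
have bI : bmeas IAB by exact: bmeas_indic.
have b1 : bmeas (fun x => IAB x * fh (U v x)) by exact: bmeasM.
have b2 : bmeas (fun x => (h x1 - h x0) * (IAB x * \1_G x)).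
  by apply: bmeasZ; apply: bmeasM => //; exact: bmeas_indic.
have b3 : bmeas (fun x => 2 * M * (IAB x * \1_(~` unit_cube) x)).
  by apply: bmeasZ; apply: bmeasM => //; exact: bmeas_indic.
(* The last term makes the comparison hold at every outcome. Off the unit cube it absorbs the jump
   and the difference of two scores, each at most [M], and its integral is 0. *)
apply: (@le_trans _ _ (\int[P]_x (IAB x * fh (U v x) +
    (h x1 - h x0) * (IAB x * \1_G x) - 2 * M * (IAB x * \1_(~` unit_cube) x)))).
  rewrite RintB//; last exact: bmeasD.
  rewrite RintD// !RintZ; try (by apply: bmeasM => //; exact: bmeas_indic).
  rewrite watermarked_Rint// !watermarked_indic//; last exact: unit_cubeC_sigma.
  rewrite pr_unit_cubeC !mulr0 subr0 mulrDr lerD2l mulrCA ler_wpM2l//.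
  by rewrite ler_wpM2l// mulr_ge0// fine_ge0.
apply: le_Rint; [by apply: bmeasB => //; exact: bmeasD|by apply: bmeasM => //; exact: bmeas_token|].
move=> x; rewrite -/(IAB x).
have -> : IAB x * fh (U v x) + (h x1 - h x0) * (IAB x * \1_G x) -
    2 * M * (IAB x * \1_(~` unit_cube) x) =
    IAB x * (fh (U v x) + (h x1 - h x0) * \1_G x - 2 * M * \1_(~` unit_cube) x) by ring.
rewrite {1 2}/IAB indicE; case: (boolP (x \in _)) => [|_]; last by rewrite !mul0r.
rewrite inE => -[Ax Bx]; rewrite !mul1r.
have [pvE pi] := Avi _ Ax.
have /andP[Uv0 Uv1] := score_itv _ hmono (U v x).
have /andP[Y0 Y1] := score_itv _ hmono (Y x).
have /andP[G0 G1] := @indic_le1 R _ G x.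
have [cx|ncx] := pselect (unit_cube x); last first.
  rewrite [\1_(~` _) x]indicE mem_set//= mulr1.
  have : (h x1 - h x0) * \1_G x <= M by rewrite -[leRHS]mulr1 ler_pM.
  by lra.
rewrite [\1_(~` _) x]indicE memNset/=; last by move/(_ cx).
rewrite mulr0 subr0.
have [pvx DEx] := pvD x.
have UvY : U v x <= Y x.
  exact: (gumbel_max_ge _ _ _ pvx DEx (unit_cubeP _ cx) _ _ pvE (amax _ Bx)).
have [Gx|nGx] := pselect (G x); last first.
  by rewrite indicE memNset// mulr0 addr0; exact: le_score.
rewrite indicE mem_set// mulr1.
have Uvx0 : U v x <= x0 by have := Gx v I; rewrite /= /E eqxx /= in_itv.
have Ui : tau <= U i x by have := Gx i I; rewrite /= /E (negbTE iv) eqxx /= in_itv/= andbT.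
have x001 : 0 < x0 < x1 by rewrite x0_gt0.
have wv := gumbel_max_neq _ _ _ pvx DEx (unit_cubeP _ cx) _ _ pvE (amax _ Bx)
  i x0 x1 D0 x001 x1_lt1 pi Uvx0 Ui.
have Yx1 : x1 <= Y x.
  have := Gx (tok x) I; rewrite /= /E (negbTE wv).
  case: ifP => _; rewrite /= in_itv/= andbT// => h'; exact: le_trans h'.
have := le_score _ hmono _ _ Yx1; have := le_score _ hmono _ _ Uvx0.
by rewrite (clamp01_id _ x0_itv) (clamp01_id _ x1_itv) => ? ?; lra.
Qed.

(** The sign is reversed to fit the upper tail bound. The cover is indexed by pairs of a modal token
    and a runner-up; both are determined by the past. *)
Lemma watermark_lower_drift A : <<s F >> A ->
  \int[P]_x (\1_A x * - (fh (Y x) - E0 h)) <=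
  - (eps * D * ((h x1 - h x0) * gain)) * pr A.
Proof.
have bY : bmeas (fun x => fh (Y x) - E0 h).
  by apply: bmeasB; [exact: bmeas_token|exact: bmeas_cst].
move: A; apply: (finite_cover_Rint_le _ _ Fm (W * W)%type
  (fun vi => [set x | [/\ vi.2 != vi.1, p vi.1 x = 1 - D & D / N <= p vi.2 x]])).
- exact: bmeasN.
- move=> [v i] /=; case: (boolP (i == v)) => iv.
    rewrite (_ : [set x | _] = set0); last by apply/seteqP; split=> // x [].
    exact: (@measurable0 _ (g_sigma_algebraType F)).
  rewrite (_ : [set x | _] = p v @^-1` [set (1 - D)] `&` p i @^-1` `[D / N, +oo[).
    apply: (@measurableI _ (g_sigma_algebraType F)).
      by apply: sub_sigma_algebra; exact: pF.
    by apply: sub_sigma_algebra; exact: pF.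
  apply/seteqP; split=> x /=; rewrite in_itv/= andbT; first by case.
  by case=> ? ?; split.
- move=> x; have [pvx DEx] := pvD x.
  have [v pvE] := Delta_argmax _ _ pvx DEx.
  have [i iv pi] := Delta_runner_up _ _ pvx v D0 pvE.
  by exists (v, i); split.
move=> [v i] A FA /= Avi; have mA := mF _ FA.
have [iv|iv] := boolP (i == v).
  have -> : A = set0 by apply/seteqP; split=> // x /Avi[]; rewrite iv.
  rewrite measure0 mulr0; under eq_Rintegral do rewrite indic0 mul0r.
  by rewrite Rint_cst.
have key := gain_piece A v i FA iv (fun x Ax => let: And3 _ a b := Avi x Ax in conj a b).
under eq_Rintegral do rewrite mulrN -mulN1r.
rewrite RintZ; last by apply: bmeasM => //; exact: bmeas_indic.
rewrite Rint_split//; move: key; lra.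
Qed.

End gain.


(* Slicing [- ln (U v)] at the integers [k] reduces "[U w] overtakes the modal
   uniform [U v]" to the boxes [U v <= exp (-k)], [U w >= 1 - (k + 1) N D]. *)
Lemma overtaking_prob (v w : W) (k : nat) : v != w ->
  pr (U v @^-1` `]-oo, expR (- k%:R)] `&` U w @^-1` `[1 - k.+1%:R * (N * D), +oo[) <=
  N * D * (k.+1%:R * expR (- k%:R)).
Proof.
move=> vw; have rho0 : 0 <= k.+1%:R * (N * D) by rewrite !mulr_ge0// ltW.
rewrite pr_pair// pr_le; last by rewrite expR_ge0 expR_le1 oppr_le0 ler0n.
have -> : N * D * (k.+1%:R * expR (- k%:R)) = expR (- k%:R) * (k.+1%:R * (N * D)).
  by ring.
by rewrite ler_wpM2l ?expR_ge0// pr_near1.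
Qed.

(** The score exceeds that of [U v] only on exceptional events, and then by at most [M]. Up to a
    null set these are a very small [U v], of probability at most $N D$, and for each of at most $N$
    tokens the slices, of total probability at most $4 N D$. *)
Lemma drift_piece A v : <<s F >> A -> (forall x, A x -> p v x = 1 - D) ->
  \int[P]_x (\1_(A `&` [set x | B x]) x * fh (Y x)) <=
  eps * pr A * (E0 h + M * (N * (1 + 4 * N) * D)).
Proof.
move=> FA Av; have mA := mF _ FA.
have rho_gt0 : 0 < N * D by rewrite mulr_gt0.
(* Slicing stops at [K], chosen above $1/(N D)$, so the part left over costs no more than order
   $D$. *)
have [K KD] : exists K : nat, expR (- K%:R) <= N * D.
  exists (Num.bound (N * D)^-1).
  have := archi_boundP (ltW (etrans (invr_gt0 _) rho_gt0)).
  set K := Num.bound _ => hK.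
  rewrite expRN -[leRHS]invrK lef_pV2 ?posrE ?invr_gt0 ?expR_gt0//.
  by apply: le_trans (ltW hK) _; have := expR_ge1Dx (K%:R : R); lra.
pose S0 := U v @^-1` `]-oo, expR (- K%:R)].
pose S w (k : nat) := U v @^-1` `]-oo, expR (- k%:R)] `&`
  U w @^-1` `[1 - k.+1%:R * (N * D), +oo[.
have XS0 : <<s X >> S0 by exact: sX.
have XS w k : <<s X >> (S w k).
  by apply: (@measurableI _ (g_sigma_algebraType X)); exact: sX.
have mAB : measurable (A `&` [set x | B x]) by exact: measurableI.
pose IAB x : R := \1_(A `&` [set x | B x]) x.
have bI : bmeas IAB by exact: bmeas_indic.
have bX E : <<s X >> E -> bmeas (fun x => IAB x * \1_E x).
  by move=> XE; apply: bmeasM => //; apply: bmeas_indic; exact: mX.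
have b1 : bmeas (fun x => IAB x * fh (U v x)) by exact: bmeasM.
pose Q x := IAB x * \1_S0 x + (\sum_(w | w != v) \sum_(k < K) IAB x * \1_(S w k) x) +
  IAB x * \1_(~` unit_cube) x.
have bS w : bmeas (fun x => \sum_(k < K) IAB x * \1_(S w k) x).
  by apply: bmeas_sum => k; exact: bX.
have bSS : bmeas (fun x => \sum_(w | w != v) \sum_(k < K) IAB x * \1_(S w k) x).
  by apply: bmeas_sum => w; exact: bS.
have bQ : bmeas Q.
  by apply: bmeasD; [apply: bmeasD => //|]; apply: bX => //; exact: unit_cubeC_sigma.
apply: (@le_trans _ _ (\int[P]_x (IAB x * fh (U v x) + M * Q x))).
  apply: le_Rint.
  - by apply: bmeasM => //; exact: bmeas_token.
  - by apply: bmeasD => //; exact: bmeasZ.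
  move=> x; rewrite -/(IAB x).
  have -> : IAB x * fh (U v x) + M * Q x = IAB x * (fh (U v x) + M * (\1_S0 x +
      (\sum_(w | w != v) \sum_(k < K) \1_(S w k) x) + \1_(~` unit_cube) x)).
    rewrite /Q; under eq_bigr do rewrite -mulr_sumr.
    by rewrite -mulr_sumr; ring.
  rewrite /IAB indicE; case: (boolP (x \in _)) => [|_]; last by rewrite !mul0r.
  rewrite inE => -[Ax Bx]; rewrite !mul1r.
  have /andP[Uv0 Uv1] := score_itv _ hmono (U v x).
  have /andP[Y0 Y1] := score_itv _ hmono (Y x).
  set SS := \sum_(w | w != v) _.
  have SS0 : 0 <= SS.
    by apply: sumr_ge0 => w _; apply: sumr_ge0 => k _; have /andP[] := @indic_le1 R _ (S w k) x.
  have /andP[S00 _] := @indic_le1 R _ S0 x.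
  have /andP[C0 _] := @indic_le1 R _ (~` unit_cube) x.
  (* One exceptional indicator equal to 1 suffices, since two scores differ by at most [M]. *)
  suff [YU|S1] : fh (Y x) <= fh (U v x) \/ 1 <= \1_S0 x + SS + \1_(~` unit_cube) x.
  - by apply: le_trans YU _; rewrite lerDl mulr_ge0// !addr_ge0.
  - have : M <= M * (\1_S0 x + SS + \1_(~` unit_cube) x) by rewrite ler_peMr.
    by lra.
  have [cx|ncx] := pselect (unit_cube x); last first.
    by right; rewrite [\1_(~` _) x]indicE mem_set//= lerDr addr_ge0.
  have [tv|tv] := eqVneq (tok x) v; first by left; rewrite tv.
  right; have [pvx DEx] := pvD x.
  have U01 := unit_cubeP _ cx.
  have near1 := gumbel_max_near1 _ _ _ pvx DEx U01 _ _ (Av _ Ax) (amax _ Bx) D0 tv.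
  have /andP[Uvx0 Uvx1] := U01 v.
  have y0 : 0 <= - ln (U v x) by rewrite oppr_ge0 ln_le0.
  have Uv_le k : k%:R <= - ln (U v x) -> U v x <= expR (- k%:R).
    by move=> ky; rewrite -[leLHS]lnK// ler_expR lerNr.
  have [Ky|[k ky yk]] := integer_part_or_large _ K y0.
    suff -> : \1_S0 x = 1 :> R by rewrite -addrA lerDl addr_ge0.
    have S0x : S0 x by rewrite /S0/= in_itv/=; exact: Uv_le.
    by rewrite indicE mem_set.
  have S1 : \1_(S (tok x) k) x = 1 :> R.
    rewrite indicE mem_set//; split; rewrite /= in_itv/= ?andbT; first exact: Uv_le.
    apply: le_trans near1; rewrite lerD2l -mulNr [leRHS]mulrC.
    by apply: ler_wpM2r; [exact: ltW | rewrite lerNl ltW].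
  apply: (@le_trans _ _ SS); last by rewrite -addrA addrCA lerDl addr_ge0.
  rewrite /SS (bigD1 (tok x))//= (bigD1 k)//= S1 -addrA lerDl addr_ge0//.
    by apply: sumr_ge0 => j _; have /andP[] := @indic_le1 R _ (S (tok x) j) x.
  by apply: sumr_ge0 => w _; apply: sumr_ge0 => j _; have /andP[] := @indic_le1 R _ (S w j) x.
rewrite RintD//; last exact: bmeasZ.
rewrite RintZ// watermarked_Rint// [leRHS]mulrDr lerD2l.
rewrite [leRHS]mulrCA ler_wpM2l//.
rewrite /Q RintD; [|by apply: bmeasD => //; exact: bX|by apply: bX; exact: unit_cubeC_sigma].
rewrite watermarked_indic//; last exact: unit_cubeC_sigma.
rewrite pr_unit_cubeC mulr0 addr0 RintD//; last exact: bX.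
rewrite watermarked_indic// Rint_sum//.
have PA0 : 0 <= eps * pr A by rewrite mulr_ge0// fine_ge0.
have layer w : w != v ->
    \int[P]_x (\sum_(k < K) IAB x * \1_(S w k) x) <= eps * pr A * (4 * (N * D)).
  move=> wv; rewrite Rint_sum; last by move=> k; exact: bX.
  under eq_bigr do rewrite watermarked_indic//.
  rewrite -mulr_sumr ler_wpM2l//.
  apply: (@le_trans _ _ (\sum_(k < K) N * D * (k.+1%:R * expR (- k%:R)))).
    by apply: ler_sum => k _; apply: overtaking_prob; rewrite eq_sym.
  by rewrite -mulr_sumr mulrC ler_wpM2r ?sum_succ_expN_le4// ltW.
have tot : \sum_(w | w != v) \int[P]_x (\sum_(k < K) IAB x * \1_(S w k) x) <=
    N * (eps * pr A * (4 * (N * D))).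
  apply: (@le_trans _ _ (\sum_(w | w != v) eps * pr A * (4 * (N * D)))).
    by apply: ler_sum => w wv; exact: layer.
  have c0 : 0 <= eps * pr A * (4 * (N * D)) by rewrite mulr_ge0// mulr_ge0// ltW.
  move: (eps * pr A * (4 * (N * D))) c0 => c c0.
  have -> : N * c = \sum_(w : W) c by rewrite sumr_const mulr_natl.
  by rewrite [leRHS](bigID (fun w => w != v))/= lerDl sumr_ge0.
have : eps * pr A * pr S0 <= eps * pr A * (N * D).
  by rewrite ler_wpM2l// /S0 pr_le// expR_ge0 expR_le1 oppr_le0 ler0n.
by move: tot; lra.
Qed.

Lemma watermark_upper_drift A : <<s F >> A ->
  \int[P]_x (\1_A x * (fh (Y x) - E0 h)) <=
  eps * D * (M * (N * (1 + 4 * N))) * pr A.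
Proof.
have bY : bmeas (fun x => fh (Y x) - E0 h).
  by apply: bmeasB; [exact: bmeas_token|exact: bmeas_cst].
move: A; apply: (finite_cover_Rint_le _ _ Fm W (fun v => p v @^-1` [set (1 - D)])) => //.
- by move=> v; apply: sub_sigma_algebra; exact: pF.
- by move=> x; have [pvx DEx] := pvD x; exact: (Delta_argmax _ _ pvx DEx).
move=> v A FA Av; rewrite Rint_split//.
by have := drift_piece A v FA Av; lra.
Qed.

End one_step.

(** * The mixture model *)

Section mixture.
Context {R : realType} {W : finType} {d : measure_display} {T : measurableType d}.
Variables (P : probability T R) (n : nat) (eps D : R).
Variables (Pv xi : nat -> W -> T -> R) (wt : nat -> T -> W) (B : nat -> T -> bool).
Hypothesis model : watermark_model P n eps D Pv xi wt B.
Variable h : R -> R.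
Hypothesis hmono : {in `[0, 1] &, {homo h : x y / x <= y}}.
Hypotheses (D0 : 0 < D) (eps0 : 0 <= eps).

Notation M := (h 1 - h 0).
Notation N := (#|W|%:R : R).
Notation F := (Fgen Pv xi wt).
Notation X := (Xgen xi).
Notation Z t x := (h (clamp01 (Yt xi wt t x)) - E0 h).

Lemma Fgen_measurable t : (t < n)%N -> F t `<=` measurable.
Proof.
move=> tn; have [mPv [mxi [mwt _]]] := model => A.
case=> [[j [w [jt [S [mS ->]]]]]|[[j [w [jt ->]]]|[j [w [jt [S [mS ->]]]]]]].
- rewrite -[X in measurable X]setTI; apply: mPv => //; exact: leq_ltn_trans tn.
- by apply: mwt; exact: ltn_trans tn.
- rewrite -[X in measurable X]setTI; apply: mxi => //; exact: ltn_trans tn.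
Qed.

Lemma Xgen_measurable t : (t < n)%N -> X t `<=` measurable.
Proof.
move=> tn A [w [S [mS ->]]]; have [_ [mxi _]] := model.
by rewrite -[X in measurable X]setTI; exact: mxi.
Qed.

Lemma bmeas_Yt t : (t < n)%N -> bmeas (fun x => h (clamp01 (Yt xi wt t x))).
Proof.
move=> tn; have [_ [mxi [mwt _]]] := model.
apply: (bmeas_token measurable (xi t) (wt t) h hmono) => // [w S mS|w]; last exact: mwt.
by rewrite -[X in measurable X]setTI; exact: mxi.
Qed.

(** For [k < t] the token [wt k] and the vector [xi k] are both among the generators of [Fgen t]. *)
Lemma adapted_Yt k t : (k < t)%N ->
  @bmeas R _ (g_sigma_algebraType (F t)) (fun x => h (clamp01 (Yt xi wt k x))).
Proof.
move=> kt.
apply: (@bmeas_token R W _ (g_sigma_algebraType (F t)) measurable (xi k) (wt k) h hmono) => //.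
- by move=> w S mS; apply: sub_sigma_algebra; right; right; exists k, w; split=> //; exists S.
- by move=> w; apply: sub_sigma_algebra; right; left; exists k, w.
Qed.

Lemma upper_drift t A : (t < n)%N -> <<s F t >> A ->
  \int[P]_x (\1_A x * Z t x) <= eps * D * (M * (N * (1 + 4 * N))) * fine (P A).
Proof.
move=> tn; have [mPv [mxi [mwt [mB [pvD [unif [prodU [_ [_ [wm [amax nonwm]]]]]]]]]]] := model.
apply: (watermark_upper_drift P eps D (F t) (X t) (Pv t) (xi t) (wt t) (B t) h hmono).
- exact: Fgen_measurable.
- exact: Xgen_measurable.
(* The index in [Fgen] goes up to [t] included for the probability vectors, so the modal token at
   [t] is known from the past. *)
- by move=> w S mS; left; exists t, w; split=> //; exists S.
- by move=> w S mS; exists w; exists S.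
- by move=> w; exact: mwt.
- exact: mB.
- by move=> x; exact: pvD.
- by move=> w; exact: unif.
- by move=> E mE; exact: prodU.
- by move=> A' E FA XE; exact: wm.
- by move=> x Bx; exact: amax.
- by move=> A' E w FA XE; exact: nonwm.
- exact: D0.
- exact: eps0.
Qed.

Lemma lower_drift x0 x1 t A : 0 < x0 -> x0 < x1 -> x1 < 1 ->
  (t < n)%N -> <<s F t >> A ->
  \int[P]_x (\1_A x * - Z t x) <=
  - (eps * D * ((h x1 - h x0) * @gain R W x0 x1)) * fine (P A).
Proof.
move=> x00 x01 x11 tn.
have [mPv [mxi [mwt [mB [pvD [unif [prodU [_ [_ [wm [amax nonwm]]]]]]]]]]] := model.
apply: (watermark_lower_drift P eps D (F t) (X t) (Pv t) (xi t) (wt t) (B t) h hmono) => //.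
- exact: Fgen_measurable.
- exact: Xgen_measurable.
- by move=> w S mS; left; exists t, w; split=> //; exists S.
- by move=> w S mS; exists w; exists S.
- by move=> w; exact: mwt.
- exact: mB.
- by move=> x; exact: pvD.
- by move=> w; exact: unif.
- by move=> E mE; exact: prodU.
- by move=> A' E FA XE; exact: wm.
- by move=> x Bx; exact: amax.
- by move=> A' E w FA XE; exact: nonwm.
Qed.

Lemma measurable_reject C a :
  measurable [set x | Th_reject h C a n (fun t => Yt xi wt t x)].
Proof.
rewrite -[X in measurable X]setTI; rewrite /Th_reject.
apply: measurable_fun_le; [exact: measurableT|exact: measurable_cst|].
apply: (measurable_sum_ord (fun t x => h (clamp01 (Yt xi wt t x)))) => t tn.
exact: (bmeas_Yt _ tn).1.
Qed.

Lemma mixture_upper_tail C a lam : 0 <= lam -> lam * M <= 1 / 2 ->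
  fine (P [set x | Th_reject h C a n (fun t => Yt xi wt t x)]) <=
  expR (- lam * (C * Num.sqrt n%:R * a n) +
        n%:R * (lam * (eps * D * (M * (N * (1 + 4 * N)))) + 2 * (lam * M) ^+ 2)).
Proof.
move=> lam0 lamM.
have -> : [set x | Th_reject h C a n (fun t => Yt xi wt t x)] =
    [set x | C * Num.sqrt n%:R * a n <= \sum_(t < n) Z t x].
  by apply/funext => x /=; rewrite Th_rejectE.
apply: (exponential_tail_bound P n F (fun t x => Z t x)) => //.
- exact: Fgen_measurable.
- move=> t tn; apply: (proj1 (_ : bmeas _)).
  by apply: bmeasB; [exact: bmeas_Yt | exact: bmeas_cst].
- move=> k t /andP[kt _]; apply: (proj1 (_ : @bmeas R _ (g_sigma_algebraType (F t)) _)).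
  by apply: bmeasB; [exact: adapted_Yt | exact: bmeas_cst].
- by move=> t x _; exact: score_dev.
- by move=> t A tn; exact: upper_drift.
Qed.

(** Non-rejection makes the sum of the opposite scores exceed the opposite threshold, while their
    drift is negative. *)
Lemma mixture_lower_tail x0 x1 C a lam : 0 < x0 -> x0 < x1 -> x1 < 1 ->
  0 <= lam -> lam * M <= 1 / 2 ->
  fine (P [set x | ~~ Th_reject h C a n (fun t => Yt xi wt t x)]) <=
  expR (lam * (C * Num.sqrt n%:R * a n) +
        n%:R * (lam * - (eps * D * ((h x1 - h x0) * @gain R W x0 x1)) +
                2 * (lam * M) ^+ 2)).
Proof.
move=> x00 x01 x11 lam0 lamM.
have mS : measurable_fun setT (fun x => \sum_(t < n) - Z t x).
  apply: (measurable_sum_ord (fun t x => - Z t x)) => t tn.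
  apply: (proj1 (_ : bmeas _)).
  by apply: bmeasN; apply: bmeasB; [exact: bmeas_Yt | exact: bmeas_cst].
have mE : measurable [set x | - (C * Num.sqrt n%:R * a n) <= \sum_(t < n) - Z t x].
  rewrite -[X in measurable X]setTI.
  by apply: measurable_fun_le => //; exact: measurable_cst.
have mNR : measurable [set x | ~~ Th_reject h C a n (fun t => Yt xi wt t x)].
  rewrite (_ : [set x | _] = ~` [set x | Th_reject h C a n (fun t => Yt xi wt t x)]).
    by apply: measurableC; exact: measurable_reject.
  by apply/seteqP; split=> x /= => [/negP|/negP].
apply: (@le_trans _ _ (fine (P [set x | - (C * Num.sqrt n%:R * a n) <= \sum_(t < n) - Z t x]))).
  rewrite fine_le ?fin_num_measure// le_measure ?inE// => x /=.
  rewrite Th_rejectE -ltNge sumrN lerN2; exact: ltW.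
rewrite -[lam * (C * _ * _)]mulrNN.
apply: (exponential_tail_bound P n F (fun t x => - Z t x)) => //.
- exact: Fgen_measurable.
- move=> t tn; apply: (proj1 (_ : bmeas _)).
  by apply: bmeasN; apply: bmeasB; [exact: bmeas_Yt | exact: bmeas_cst].
- move=> k t /andP[kt _]; apply: (proj1 (_ : @bmeas R _ (g_sigma_algebraType (F t)) _)).
  by apply: bmeasN; apply: bmeasB; [exact: adapted_Yt | exact: bmeas_cst].
- by move=> t x _; rewrite normrN; exact: score_dev.
- by move=> t A tn; exact: lower_drift.
Qed.

End mixture.

(** * Asymptotics *)

Section asymptotics.
Context {R : realType}.

(** Each error estimate below is brought to this form, with [K] independent of [n]. *)
Lemma vanishing_of_expR_bound (a f : nat -> R) (C K : R) :
  0 < C -> a n @[n --> \oo] --> +oo ->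
  (\forall n \near \oo, 0 <= f n <= expR (K - C * a n)) -> f n @[n --> \oo] --> 0.
Proof.
move=> C0 ay fle.
apply: (squeeze_cvgr fle); first exact: cvg_cst.
have Cay : C * a n @[n --> \oo] --> +oo.
  apply/cvgryPge => x; move/cvgryPge : ay => /(_ (x / C)).
  by apply: filterS => n; rewrite ler_pdivrMr// mulrC.
rewrite -[0](mulr0 (expR K)).
under eq_fun do rewrite expRD.
by apply: cvgMr; exact: (cvg_comp _ _ Cay (@cvgr_expR R)).
Qed.

Lemma rate_powR (p q : R) (n : nat) : (1 <= n)%N ->
  Num.sqrt n%:R * (npow p n * npow q n) = n%:R `^ (1 / 2 - (q + p)) :> R.
Proof.
move=> n1; have nE : (n%:R : R) != 0 by rewrite pnatr_eq0 -lt0n.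
rewrite /npow -powR12_sqrt// -!powRD ?nE ?implybT//.
by congr (_ `^ _); lra.
Qed.

Lemma sqrt_large (M : R) : 0 <= M ->
  \forall n \near \oo, (1 <= n)%N /\ M <= Num.sqrt n%:R.
Proof.
move=> M0; near=> n; split.
  by near: n; exact: nbhs_infty_ge.
rewrite -[leLHS]ger0_norm// -sqrtr_sqr ler_wsqrtr//.
by near: n; exact: nbhs_infty_ger.
Unshelve. all: by end_near. Qed.

(** Monotonicity and non-constancy give $h(0) < h(1)$. The limits at the endpoints then provide
    interior points with values on either side of the midpoint, and monotonicity orders them. *)
Lemma separating_points (h : R -> R) :
  {in `[0, 1] &, {homo h : x y / x <= y}} ->
  (exists x y, x \in `[0, 1] /\ y \in `[0, 1] /\ h x != h y) ->
  h x @[x --> 0^'+] --> h 0 -> h x @[x --> 1^'-] --> h 1 ->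
  exists x0 x1, [/\ 0 < x0, x0 < x1, x1 < 1 & h x0 < h x1].
Proof.
move=> hmono [x [y [x01 [y01 hxy]]]] h0 h1.
have I0 : (0 : R) \in `[0, 1] by rewrite in_itv/= lexx ler01.
have I1 : (1 : R) \in `[0, 1] by rewrite in_itv/= lexx ler01.
have h01 : h 0 < h 1.
  rewrite lt_neqAle hmono// andbT; apply/eqP => e.
  move/eqP : hxy; apply; move: (x01) (y01); rewrite !in_itv/= => /andP[? ?] /andP[? ?].
  have e0 z : z \in `[0, 1] -> h z = h 0.
    move=> z01; move: (z01); rewrite in_itv/= => /andP[? ?].
    by apply/eqP; rewrite eq_le {1}e !hmono.
  by rewrite !e0.
pose mid := (h 0 + h 1) / 2.
have [x0 [x00 x01' hx0]] : exists x0, [/\ 0 < x0, x0 < 1 & h x0 < mid].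
  apply: (@filter_ex _ (0 : R)^'+); near=> z; split.
  - by near: z; exact: nbhs_right_gt.
  - by near: z; exact: nbhs_right_lt.
  - by near: z; apply: (cvgr_lt _ h0); rewrite /mid; lra.
have [x1 [x10 x11 hx1]] : exists x1, [/\ 0 < x1, x1 < 1 & mid < h x1].
  apply: (@filter_ex _ (1 : R)^'-); near=> z; split.
  - by near: z; exact: nbhs_left_gt.
  - by near: z; exact: nbhs_left_lt.
  - by near: z; apply: (cvgr_gt _ h1); rewrite /mid; lra.
have hh := lt_trans hx0 hx1.
exists x0, x1; split=> //; rewrite ltNge; apply/negP => x10'.
by move: hh; rewrite ltNge => /negP; apply; apply: hmono => //; rewrite in_itv/= !ltW.
Unshelve. all: by end_near. Qed.

End asymptotics.

(** * The detection boundary $q + p = 1/2$ *)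

Theorem theorem4p4
  (R : realType) (W : finType) (p q : R) (eps Dn : nat -> R)
  (* the H1^mix models, one probability space per n *)
  (d : nat -> measure_display) (T : forall n, measurableType (d n))
  (Pr : forall n, probability (T n) R)
  (Pv : forall n, nat -> W -> T n -> R) (xi : forall n, nat -> W -> T n -> R)
  (wt : forall n, nat -> T n -> W) (B : forall n, nat -> T n -> bool)
  (* the H0 models: Y_1..Y_n i.i.d. U(0,1) *)
  (d0 : nat -> measure_display) (T0 : forall n, measurableType (d0 n))
  (P0 : forall n, probability (T0 n) R) (Y0 : forall n, nat -> T0 n -> R)
  (* score function, threshold sequence and constant *)
  (h : R -> R) (a : nat -> R) (C : R) :
  0 <= p -> 0 <= q ->
  asymp (npow p) eps -> asymp (npow q) Dn ->
  (forall n, watermark_model (Pr n) n (eps n) (Dn n) (Pv n) (xi n) (wt n) (B n)) ->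
  (forall n, H0_model (P0 n) n (Y0 n)) ->
  (* (i) non-decreasing on [0,1] *)
  {in `[0, 1] &, {homo h : x y / x <= y}} ->
  (* (ii) non-constant on [0,1] *)
  (exists x y, x \in `[0, 1] /\ y \in `[0, 1] /\ h x != h y) ->
  (* (iv) no discontinuity at 0 and at 1 *)
  h x @[x --> 0^'+] --> h 0 ->
  h x @[x --> 1^'-] --> h 1 ->
  (forall n, 0 < a n) -> a n @[n --> \oo] --> +oo ->
  (forall g : R, 0 < g -> (a n / n%:R `^ g) @[n --> \oo] --> 0) ->
  0 < C ->
  let err n :=
    fine (P0 n [set x | Th_reject h C a n (fun t => Y0 n t x)]) +
    fine (Pr n [set x | ~~ Th_reject h C a n (fun t => Yt (xi n) (wt n) t x)]) in
  (q + p < 1 / 2 -> err n @[n --> \oo] --> (0 : R)) /\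
  (q + p > 1 / 2 -> err n @[n --> \oo] --> (1 : R)).
Proof.
move=> p0 q0 [e1 [e2 [e1_gt0 [e2_gt0 epsE]]]] [d1 [d2 [d1_gt0 [d2_gt0 DnE]]]].
move=> model null hmono hnc h0 h1 a_gt0 ay a_slow C_gt0 err.
have [x0 [x1 [x0_gt0 x01 x1_lt1 hx]]] := separating_points h hmono hnc h0 h1.
pose M := h 1 - h 0.
have M0 : 0 <= M by have /andP[u v] := score_itv h hmono 0; rewrite subr_ge0 (le_trans u v).
pose N : R := #|W|%:R.
(* [c1] and [c2] bound the drift per unit of $\varepsilon_n \Delta_n$ from below and from above. *)
pose c1 := (h x1 - h x0) * @gain R W x0 x1.
pose c2 := M * (N * (1 + 4 * N)).
have c1_gt0 : 0 < c1.
  rewrite mulr_gt0 ?subr_gt0// /gain.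
  have lx : ln x1 < 0 by rewrite ln_lt0// x1_lt1 (lt_trans x0_gt0).
  have N_gt0 : 0 < N.
    (* The model at [n = 1] is used because at [n = 0] there is no token to supply a probability
       vector. *)
    have [_ [_ [_ [_ [pvD _]]]]] := model 1%N.
    exact: (prob_vector_card_gt0 _ (pvD 0%N point isT).1).
  rewrite !mulr_gt0 ?invr_gt0 ?exprn_gt0 ?oppr_gt0 ?subr_gt0//.
  by rewrite (lt_trans lx).
have c2_ge0 : 0 <= c2 by rewrite !mulr_ge0// addr_ge0// mulr_ge0.
pose rate n : R := n%:R `^ (1 / 2 - (q + p)).
have rate_bounds n : (1 <= n)%N -> 0 <= eps n /\ 0 < Dn n /\
    e1 * d1 * rate n <= Num.sqrt n%:R * (eps n * Dn n) <= e2 * d2 * rate n.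
  move=> n1; have [el eu] := epsE n n1; have [dl du] := DnE n n1.
  have n_gt0 : 0 < (n%:R : R) by rewrite ltr0n.
  have np : 0 < npow p n by exact: powR_gt0.
  have nq : 0 < npow q n by exact: powR_gt0.
  have e0 : 0 < eps n by apply: lt_le_trans el; exact: mulr_gt0.
  have D0 : 0 < Dn n by apply: lt_le_trans dl; exact: mulr_gt0.
  split; first exact: ltW.
  split=> //; rewrite /rate -rate_powR//.
  have E (u v : R) : u * v * (Num.sqrt n%:R * (npow p n * npow q n)) =
      Num.sqrt n%:R * ((u * npow p n) * (v * npow q n)) by ring.
  have le1 : 0 <= e1 * npow p n by rewrite mulr_ge0// ltW.
  have ld1 : 0 <= d1 * npow q n by rewrite mulr_ge0// ltW.
  rewrite !E; apply/andP; split; apply: ler_wpM2l; rewrite ?sqrtr_ge0//.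
    exact: ler_pM.
  by apply: ler_pM => //; exact: ltW.
(* With [lam = n^-1/2] the threshold contributes [C a_n], the drift
   [sqrt n * eps * Dn] and the quadratic term only a constant. *)
have lam_facts n : (1 <= n)%N -> 2 * M <= Num.sqrt n%:R ->
    exists lam : R, [/\ 0 <= lam, lam * M <= 1 / 2,
      lam * (C * Num.sqrt n%:R * a n) = C * a n,
      n%:R * (2 * (lam * M) ^+ 2) = 2 * M ^+ 2 &
      forall r, n%:R * (lam * r) = Num.sqrt n%:R * r].
  move=> n1 Ms; have s0 : 0 < Num.sqrt n%:R :> R by rewrite sqrtr_gt0 ltr0n.
  have sE : (n%:R : R) = Num.sqrt n%:R * Num.sqrt n%:R by rewrite -expr2 sqr_sqrtr.
  have s_neq0 : Num.sqrt n%:R != 0 :> R by rewrite gt_eqF.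
  exists (Num.sqrt n%:R)^-1; split.
  - by rewrite invr_ge0 ltW.
  - by rewrite mulrC ler_pdivrMr//; lra.
  - by field.
  - by rewrite {1}sE; field.
  - by move=> r; rewrite {1}sE; field.
(* The Type I error is at most $\exp(2M^2 - C a_n)$ in both regimes. *)
have type1 : fine (P0 n [set x | Th_reject h C a n (fun t => Y0 n t x)]) @[n --> \oo] --> 0.
  apply: (vanishing_of_expR_bound a _ C (2 * M ^+ 2)) => //.
  have := @sqrt_large R (2 * M) (mulr_ge0 (ler0n _ _) M0).
  apply: filterS => n [n1 Ms]; rewrite fine_ge0//=.
  have [lam [lam0 lamM l1 l2 _]] := lam_facts n n1 Ms.
  apply: le_trans (null_tail h hmono _ _ _ (null n) C a lam lam0 lamM) _.
  by rewrite mulNr l1 l2 addrC.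
split=> pq.
  rewrite -[0](addr0 0); apply: cvgD => //.
  apply: (vanishing_of_expR_bound a _ C (2 * M ^+ 2)) => //.
  pose g := 1 / 2 - (q + p).
  have g_gt0 : 0 < g by rewrite subr_gt0.
  (* With this [s], $a_n < s n^g$ makes the drift term at least $2 C a_n$, twice the threshold term,
     so the exponent is at most $2M^2 - C a_n$. *)
  pose s := c1 * (e1 * d1) / (2 * C).
  have s_gt0 : 0 < s :=
    divr_gt0 (mulr_gt0 c1_gt0 (mulr_gt0 e1_gt0 d1_gt0)) (mulr_gt0 (ltr0Sn _ 1) C_gt0).
  have slow : \forall n \near \oo, a n / n%:R `^ g < s.
    by apply: (cvgr_lt _ (a_slow g g_gt0)).
  have large := @sqrt_large R (2 * M) (mulr_ge0 (ler0n _ _) M0).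
  apply: filterS2 slow large => n an [n1 Ms]; rewrite fine_ge0//=.
  have [eps0 [D0 /andP[rl _]]] := rate_bounds n n1.
  have [lam [lam0 lamM l1 l2 l3]] := lam_facts n n1 Ms.
  apply: le_trans (mixture_lower_tail (Pr n) n _ _ _ _ _ _ (model n) h hmono D0 eps0
    x0 x1 C a lam x0_gt0 x01 x1_lt1 lam0 lamM) _.
  rewrite ler_expR l1 mulrDr l2 l3 -/c1.
  have drift : 2 * (C * a n) <= Num.sqrt n%:R * (eps n * Dn n * c1).
    have ng : 0 < (n%:R : R) `^ g by rewrite powR_gt0// ltr0n.
    move: an; rewrite ltr_pdivrMr// => an.
    have -> : Num.sqrt n%:R * (eps n * Dn n * c1) = c1 * (Num.sqrt n%:R * (eps n * Dn n)).
      by ring.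
    apply: (@le_trans _ _ (c1 * (e1 * d1 * rate n))); last by rewrite ler_pM2l.
    have -> : c1 * (e1 * d1 * rate n) = 2 * C * (s * n%:R `^ g).
      by rewrite /s /rate -/g; field; rewrite gt_eqF.
    by rewrite mulrA ler_pM2l ?mulr_gt0// ltW.
  by move: drift; lra.
(* The Type II error is written as a complement; it remains to show that the rejection probability
   under the mixture tends to 0. *)
have -> : err = fun n => fine (P0 n [set x | Th_reject h C a n (fun t => Y0 n t x)]) +
    (1 - fine (Pr n [set x | Th_reject h C a n (fun t => Yt (xi n) (wt n) t x)])).
  apply/funext => n; congr (_ + _).
  have mR := measurable_reject (Pr n) n _ _ _ _ _ _ (model n) h hmono C a.
  rewrite (_ : [set x | _] = ~` [set x | Th_reject h C a n (fun t => Yt (xi n) (wt n) t x)]).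
    by rewrite probability_setC// fineB ?fin_num_measure.
  by apply/seteqP; split=> x /= => [/negP|/negP].
have type2 : fine (Pr n [set x | Th_reject h C a n
    (fun t => Yt (xi n) (wt n) t x)]) @[n --> \oo] --> 0; last first.
  have lim0 : (0 : R) + (1 - 0) = 1 by rewrite add0r subr0.
  by rewrite -[X in _ --> X]lim0; apply: cvgD => //; apply: cvgB type2; exact: cvg_cst.
apply: (vanishing_of_expR_bound a _ C (e2 * d2 * c2 + 2 * M ^+ 2)) => //.
have := @sqrt_large R (2 * M) (mulr_ge0 (ler0n _ _) M0).
apply: filterS => n [n1 Ms]; rewrite fine_ge0//=.
have [eps0 [D0 /andP[_ ru]]] := rate_bounds n n1.
have [lam [lam0 lamM l1 l2 l3]] := lam_facts n n1 Ms.
apply: le_trans (mixture_upper_tail (Pr n) n _ _ _ _ _ _ (model n) h hmono D0 eps0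
  C a lam lam0 lamM) _.
rewrite ler_expR mulNr l1 mulrDr l2 l3 -/c2.
(* The exponent of [rate] is negative here, so the total drift stays bounded while $a_n$
   diverges. *)
have r1 : rate n <= 1.
  by rewrite -(powRr0 n%:R) /rate ler_powR ?ler1n// subr_le0 ltW.
have : Num.sqrt n%:R * (eps n * Dn n * c2) <= e2 * d2 * c2.
  rewrite mulrA ler_wpM2r//; apply: le_trans ru _.
  by rewrite -[leRHS]mulr1 ler_pM2l ?mulr_gt0.
by lra.
Qed.
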